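(* Let $n\ge 2$ and let $F$ be any distribution of private values with support contained in $[\underline v,\overline v]$, $0\le\underline v\le\overline v<\infty$ (the lowest and highest points of $\text{supp}(F)$). Then there exist beliefs $(l^\star,\mu^\star,u^\star)$, held by every bidder, such that, with every bidder using the minimax-loss bidding function $\beta^{\text{IND}}(\cdot|l^\star,\mu^\star,u^\star)$ for the individual belief set $\mathcal B_i(l^\star,\mu^\star,u^\star)$, the tuple $(\beta^{\text{IND}},l^\star,\mu^\star,u^\star)$ is a moment equilibrium, and $v\mapsto\beta^{\text{IND}}(v|l^\star,\mu^\star,u^\star)$ is strictly increasing in $v$.
   Context: First-price sealed-bid auction for a single good with a set $N$ of $n\ge2$ risk-neutral bidders; values i.i.d. from $F$; highest bid wins and pays its bid; ties broken uniformly at random; payoff $v_i-b_i$ upon winning (shared equally among tying winners), $0$ otherwise; strategies are measurable maps $\beta_i:\text{supp}(F)\to\mathbb R_+$. For opponents' joint bid distribution $B_{-i}$, $U_i(b,B_{-i})$ is the expected payoff and $\lambda_i(b,B_{-i}|v_i)=\sup_{\tilde b\in\mathbb R_+}U_i(\tilde b,B_{-i})-U_i(b,B_{-i})$ is the loss. Individual belief set: $\mathcal B_{ij}(l,\mu,u)=\{B\text{ on }\mathbb R_+:\int_l^udB=1,\int x\,dB(x)=\mu\}$ and $\mathcal B_i(l,\mu,u)$ is the set of product distributions $\prod_{j\ne i}B_j$ with $B_j\in\mathcal B_{ij}(l,\mu,u)$. A minimax-loss bid for value $v_i$ is any element of $\arg\inf_{b\in\mathbb R_+}\sup_{B_{-i}\in\mathcal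 B_i(l,\mu,u)}\lambda_i(b,B_{-i}|v_i)$, denoted $\beta^{\text{IND}}(v_i|l,\mu,u)$. Moment equilibrium: a tuple $(\beta,l,\mu,u)$ with $\beta=(\beta_i)_{i\in N}$ and per-player beliefs $(l_i,\mu_i,u_i)$ such that (1) for each $i$ and $v_i\in\text{supp}(F)$, $\beta_i(v_i|l_i,\mu_i,u_i)$ is a minimax-loss bid for $\mathcal B_i(l_i,\mu_i,u_i)$; (2) $\int\beta_i(v|l_i,\mu_i,u_i)\,dF(v)=\mu_j$ for all $i$ and $j\ne i$; (3) for all $i$ and $j\ne i$, $\inf_{v\in\text{supp}(F)}\beta_i(v|l_i,\mu_i,u_i)=l_j$ and $\sup_{v\in\text{supp}(F)}\beta_i(v|l_i,\mu_i,u_i)=u_j$. *)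

(* Defs.v *)
From HB Require Import structures.
From mathcomp Require Import all_boot all_order all_algebra.
From mathcomp Require Import all_classical all_reals all_analysis.
Set Implicit Arguments. Unset Strict Implicit. Unset Printing Implicit Defensive.
Import Order.TTheory GRing.Theory Num.Theory.
Import numFieldNormedType.Exports.
Local Open Scope classical_set_scope.
Local Open Scope ring_scope.

Section Defs.
Variable R : realType.

Definition supp (P : probability R R) : set R :=
  [set x | forall e : R, 0 < e -> (0 < P (ball x e))%E].

Definition belief (l mu u : R) (B : probability R R) : Prop :=
  B `[0, +oo[%classic = 1%E /\ B `[l, u]%classic = 1%E /\ (\int[B]_x (x%:E) = mu%:E)%E.

Definition pr (B : probability R R) (A : set R) : R := fine (B A).

(* Probability that bidder i bidding b wins, with uniform tie-breaking,
   when opponents j <> i bid independently according to B j.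
   Sum over the set T of opponents that tie at b; all other opponents
   bid strictly below b; the winner is then drawn among |T|+1 bidders. *)
Definition win_share (n : nat) (i : 'I_n) (B : 'I_n -> probability R R)
    (b : R) : R :=
  \sum_(T : {set 'I_n} | T \subset [set~ i])
     (\prod_(j in T) pr (B j) [set b]) *
     (\prod_(j in [set~ i] :\: T) pr (B j) [set x | x < b]) /
     (#|T|.+1)%:R.

Definition payoff (n : nat) (i : 'I_n) (v : R) (B : 'I_n -> probability R R)
    (b : R) : R := (v - b) * win_share i B b.

Definition loss (n : nat) (i : 'I_n) (v : R) (B : 'I_n -> probability R R)
    (b : R) : \bar R :=
  (ereal_sup [set (payoff i v B b')%:E | b' in [set x : R | (0 <= x)%R]]
    - (payoff i v B b)%:E)%E.

(* worst-case loss over the individual belief set B_i(l, mu, u):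
   product distributions of opponents' bids, each in B_ij(l, mu, u) *)
Definition worst_loss (n : nat) (i : 'I_n) (l mu u v b : R) : \bar R :=
  ereal_sup [set loss i v B b | B in
     [set B : 'I_n -> probability R R | forall j, j != i -> belief l mu u (B j)]].

Definition minimax_bid (n : nat) (i : 'I_n) (l mu u v b : R) : Prop :=
  0 <= b /\
  worst_loss i l mu u v b =
    ereal_inf [set worst_loss i l mu u v b' | b' in [set x : R | (0 <= x)%R]].

Definition moment_equilibrium (n : nat) (F : probability R R)
    (beta : 'I_n -> R -> R) (l mu u : 'I_n -> R) : Prop :=
  (forall i, measurable_fun (supp F) (beta i)) /\
  (forall i v, supp F v -> 0 <= beta i v) /\
  (forall i v, supp F v -> minimax_bid i (l i) (mu i) (u i) v (beta i v)) /\
  (forall i j, j != i -> (\int[F]_(v in supp F) (beta i v)%:E)%E = (mu j)%:E) /\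
  (forall i j, j != i ->
     ereal_inf [set (beta i v)%:E | v in supp F] = (l j)%:E /\
     ereal_sup [set (beta i v)%:E | v in supp F] = (u j)%:E).

End Defs.

(* Main.v *)
Require Import Defs.
From HB Require Import structures.
From mathcomp Require Import all_boot all_order all_algebra.
From mathcomp Require Import all_classical all_reals all_analysis.
From mathcomp Require Import measurable_realfun lebesgue_integral_under ring lra.
Import Order.TTheory GRing.Theory Num.Theory.
Import numFieldNormedType.Exports.
Local Open Scope classical_set_scope.
Local Open Scope ring_scope.

(** Against opponents bidding in [[l, u]] with mean [mu], an overbid [b] can lose
    at most the supremum over [x <= b] of [(b - x) h(x)^(n-1)], where [h(x)] is the
    largest probability that one opponent bids at most [x]; an underbid can lose at
    most the supremum over [x >= b] of [(v - x) h(x)^(n-1)], times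
    [1 - q(b)^(n-1)], where [q(b)] is the smallest probability that one opponent
    bids below [b].  Both bounds are approached by two-point opponent bids, the
    first increases and the second decreases in [b], so the bid that equalizes them
    is a minimax-loss bid.

    In units where [l = 0] and [u = 1], a belief is the single number
    [r = (u - mu) / (u - l)].  For [l = vl], the condition that the highest type
    bids exactly [u] determines [u - l] explicitly as a function of [r], because at
    [b = u] the overbid loss is [u - mu].  The remaining condition, that the mean
    bid is [mu], is one equation in [r], solved by the intermediate value theorem:
    as [r] tends to [1] the bids of high types stay bounded away from [l] in these
    units whereas the mean tends to [l], and as [r] tends to [0] the mean tends to
    [vh] whereas bids never exceed values. *)

(** * Loss-equalizing bids in normalised units *)

Section normalised_bid.
Context {R : realType}.
Variable k : nat.
Hypothesis k_gt0 : (0 < k)%N.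
Implicit Types r a nu s x : R.

Lemma le_expr x s : 0 <= x -> x <= s -> x ^+ k <= s ^+ k.
Proof. by move=> x0 xs; rewrite lerXn2r// nnegrE (le_trans x0). Qed.

(* In units where opponents bid in [0, 1] with mean [1 - r]: the largest
   probability that an opponent bids at most [x]. *)
Definition below_max r x : R := r / Num.max r (1 - x).

(* The smallest probability that an opponent bids below [s]. *)
Definition below_min r s : R := 1 - (1 - r) / Num.max s (1 - r).

(** Clamping the bid at [a] and the margin at [0] lets [x] range over all reals: the gains form a
    nonempty set, bounded for [0 < r], whose [sup] only involves bids at least [a]. *)
Definition gain r a nu x : R :=
  Num.max 0 (nu - Num.max x a) * below_max r (Num.max x a) ^+ k.

Definition best_gain r a nu : R := sup (range (gain r a nu)).

(** * Bounds, monotonicity and Lipschitz estimates for the best gain *)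

Lemma below_max_gt0 r x : 0 < r -> 0 < below_max r x.
Proof. by move=> r0; rewrite divr_gt0// lt_max r0. Qed.

Lemma below_max_ge0 r x : 0 < r -> 0 <= below_max r x.
Proof. by move=> r0; exact/ltW/below_max_gt0. Qed.

Lemma below_max_le1 r x : 0 < r -> below_max r x <= 1.
Proof. by move=> r0; rewrite ler_pdivrMr ?lt_max ?r0// mul1r le_max lexx. Qed.

Lemma below_max_homo r : 0 < r -> {homo below_max r : x y / x <= y}.
Proof.
move=> r0 x y xy; rewrite ler_pM2l// lef_pV2 ?posrE ?lt_max ?r0//.
by rewrite ge_max !le_max lexx/= lerB// orbT.
Qed.

Lemma below_max_ge r x : 0 < r < 1 -> 0 <= x -> r <= below_max r x.
Proof.
move=> /andP[r0 r1] x0; rewrite ler_pdivlMr ?lt_max ?r0//.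
rewrite ler_piMr ?(ltW r0)// ge_max (ltW r1)/=; lra.
Qed.

Lemma below_max1 r x : 0 < r -> 1 - r <= x -> below_max r x = 1.
Proof.
by move=> r0 xr; rewrite /below_max max_l ?divff ?gt_eqF//; lra.
Qed.

Lemma expr_below_max r x : 0 < r -> 0 < below_max r x ^+ k <= 1.
Proof.
by move=> r0; rewrite exprn_gt0 ?below_max_gt0// exprn_ile1 ?below_max_le1 ?ltW ?below_max_gt0.
Qed.

Lemma expr_below_max_homo r : 0 < r -> {homo (fun x => below_max r x ^+ k) : x y / x <= y}.
Proof.
by move=> r0 x y xy; apply: le_expr; [exact: below_max_ge0|exact: below_max_homo].
Qed.

Lemma gain_ge0 r a nu x : 0 < r -> 0 <= gain r a nu x.
Proof.
by move=> r0; rewrite mulr_ge0 ?le_max ?lexx// exprn_ge0// ltW ?below_max_gt0.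
Qed.

Lemma gain_le r a nu x : 0 < r -> gain r a nu x <= Num.max 0 (nu - a).
Proof.
move=> r0; have /andP[h0 h1] := expr_below_max r (Num.max x a) r0.
apply: (@le_trans _ _ (Num.max 0 (nu - Num.max x a))).
  by rewrite ler_piMr// le_max lexx.
by rewrite ge_max !le_max lexx/= lerB ?orbT// le_max lexx orbT.
Qed.

Lemma has_sup_gain r a nu : 0 < r -> has_sup (range (gain r a nu)).
Proof.
move=> r0; split; first by exists (gain r a nu 0); exists 0.
by exists (Num.max 0 (nu - a)) => _ [x _ <-]; exact: gain_le.
Qed.

Lemma gain_le_best r a nu x : 0 < r -> gain r a nu x <= best_gain r a nu.
Proof. by move=> r0; apply: sup_upper_bound; [exact: has_sup_gain|exists x]. Qed.

Lemma best_gain_le r a nu c : (forall x, gain r a nu x <= c) -> best_gain r a nu <= c.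
Proof.
by move=> H; apply: ge_sup => [|_ [x _ <-]//]; exists (gain r a nu 0); exists 0.
Qed.

Lemma best_gain_adherent r a nu e : 0 < r -> 0 < e ->
  exists x, best_gain r a nu - e < gain r a nu x.
Proof.
by move=> r0 e0; have [_ [x _ <-] H] := sup_adherent e0 (has_sup_gain r a nu r0); exists x.
Qed.

Lemma best_gain_ge0 r a nu : 0 < r -> 0 <= best_gain r a nu.
Proof. by move=> r0; apply: le_trans (gain_le_best r a nu 0 r0); exact: gain_ge0. Qed.

Lemma best_gain_ub r a nu : 0 < r -> best_gain r a nu <= Num.max 0 (nu - a).
Proof. by move=> r0; apply: best_gain_le => x; exact: gain_le. Qed.

Lemma best_gain_term r a nu x : 0 < r -> a <= x ->
  (nu - x) * below_max r x ^+ k <= best_gain r a nu.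
Proof.
move=> r0 ax; apply: le_trans (gain_le_best r a nu x r0).
by rewrite /gain (max_l ax) ler_pM2r ?exprn_gt0 ?below_max_gt0// le_max lexx orbT.
Qed.

Lemma best_gain0 r a nu : 0 < r -> nu <= a -> best_gain r a nu = 0.
Proof.
move=> r0 na; apply/eqP; rewrite eq_le best_gain_ge0// andbT.
by rewrite (le_trans (best_gain_ub _ _ _ r0))// ge_max lexx/=; lra.
Qed.

(** From [1 - r] on the winning bound is already [1], so a higher bid only costs more and [x = a] is
    best. *)
Lemma best_gain_above r a nu : 0 < r -> 1 - r <= a ->
  best_gain r a nu = Num.max 0 (nu - a).
Proof.
move=> r0 ra; apply/eqP; rewrite eq_le best_gain_ub//=.
rewrite ge_max best_gain_ge0//=.
by have := best_gain_term r a nu a r0 (lexx _); rewrite below_max1// expr1n mulr1.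
Qed.

Lemma best_gain_Lip_r r a nu nu' : 0 < r ->
  best_gain r a nu <= best_gain r a nu' + `|nu - nu'|.
Proof.
move=> r0; apply: best_gain_le => x.
apply: (@le_trans _ _ (gain r a nu' x + `|nu - nu'|)); last first.
  by rewrite lerD2r; exact: gain_le_best.
have /andP[h0 h1] := expr_below_max r (Num.max x a) r0.
rewrite /gain; set h := _ ^+ k; set m := Num.max x a.
apply: (@le_trans _ _ ((Num.max 0 (nu' - m) + `|nu - nu'|) * h)); last first.
  by rewrite mulrDl lerD2l ler_piMr.
rewrite ler_pM2r// ge_max addr_ge0 ?le_max ?lexx//=.
have := ler_norm (nu - nu'); have : nu' - m <= Num.max 0 (nu' - m) by rewrite le_max lexx orbT.
lra.
Qed.

Lemma best_gain_homo_r r a nu nu' : 0 < r -> nu <= nu' ->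
  best_gain r a nu <= best_gain r a nu'.
Proof.
move=> r0 nn; apply: best_gain_le => x; apply: le_trans (gain_le_best r a nu' x r0).
rewrite ler_pM2r ?exprn_gt0 ?below_max_gt0// ge_max !le_max lexx/=.
by rewrite lerD2r nn orbT.
Qed.

(** On nonnegative bids [below_max] is at least [r], so the higher value adds at least
    [(nu' - nu) * r ^+ k]. *)
Lemma best_gain_lt_r r a nu nu' : 0 < r < 1 -> 0 <= a -> a <= nu -> nu < nu' ->
  best_gain r a nu < best_gain r a nu'.
Proof.
move=> /[dup] r01 /andP[r0 r1] a0 an nn.
have rk : 0 < r ^+ k by rewrite exprn_gt0.
suff : best_gain r a nu <= best_gain r a nu' - (nu' - nu) * r ^+ k.
  have : 0 < (nu' - nu) * r ^+ k by rewrite mulr_gt0// subr_gt0.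
  lra.
apply: best_gain_le => x; rewrite /gain; set m := Num.max x a.
have am : a <= m by rewrite le_max lexx orbT.
have hm y : 0 <= y -> r ^+ k <= below_max r y ^+ k.
  by move=> y0; apply: le_expr; [exact: ltW|exact: below_max_ge].
have [nm|mn] := leP nu m.
  rewrite max_l ?subr_le0// mul0r.
  have := best_gain_term r a nu' a r0 (lexx _).
  have : (nu' - nu) * r ^+ k <= (nu' - a) * below_max r a ^+ k.
    by apply: ler_pM => //; [lra|exact: ltW|lra|exact: hm].
  lra.
rewrite max_r ?subr_ge0 ?(ltW mn)//.
have := best_gain_term r a nu' m r0 am.
have : (nu' - nu) * r ^+ k <= (nu' - nu) * below_max r m ^+ k.
  by rewrite ler_pM2l ?subr_gt0//; apply: hm; exact: le_trans am.
lra.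
Qed.

Lemma best_gain_homo_l r a a' nu : 0 < r -> a <= a' ->
  best_gain r a' nu <= best_gain r a nu.
Proof.
move=> r0 aa; apply: best_gain_le => x; apply: le_trans (gain_le_best r a nu (Num.max x a') r0).
by rewrite /gain (max_l (x := Num.max x a')) // le_max aa orbT.
Qed.

(** Raising the floor on bids costs at most [a' - a] in margin, and the winning bound does not
    fall. *)
Lemma best_gain_Lip_l r a a' nu : 0 < r -> a <= a' ->
  best_gain r a nu <= best_gain r a' nu + (a' - a).
Proof.
move=> r0 aa; apply: best_gain_le => x.
apply: (@le_trans _ _ (gain r a' nu x + (a' - a))); last first.
  by rewrite lerD2r; exact: gain_le_best.
rewrite /gain; set m := Num.max x a; set m' := Num.max x a'.
have mm : m <= m' by rewrite ge_max !le_max lexx/= aa orbT.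
have mm' : m' - m <= a' - a.
  rewrite lerBlDr /m' ge_max; have : x <= m /\ a <= m by rewrite !le_max !lexx orbT.
  by move=> [? ?]; apply/andP; split; lra.
have /andP[h0 h1] := expr_below_max r m r0.
have /andP[h0' h1'] := expr_below_max r m' r0.
apply: (@le_trans _ _ (Num.max 0 (nu - m) * below_max r m' ^+ k)).
  by rewrite ler_wpM2l ?le_max ?lexx// expr_below_max_homo.
apply: (@le_trans _ _ ((Num.max 0 (nu - m') + (a' - a)) * below_max r m' ^+ k)).
  rewrite ler_pM2r// ge_max addr_ge0 ?le_max ?lexx ?subr_ge0//=.
  have : nu - m' <= Num.max 0 (nu - m') by rewrite le_max lexx orbT.
  lra.
by rewrite mulrDl lerD2l ler_piMr// subr_ge0.
Qed.

(** As [below_max] increases with its parameter, only [r' < r] needs an estimate. There, passing to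
    the smaller denominator, itself at least [c], leaves the difference of the numerators. *)
Lemma best_gain_Lip_param c r r' a nu : 0 < c -> c <= r -> c <= r' ->
  best_gain r a nu <=
  best_gain r' a nu + Num.max 0 (nu - a) / c ^+ k * `|r ^+ k - r' ^+ k|.
Proof.
move=> c0 cr cr'.
have r0 := lt_le_trans c0 cr; have r0' := lt_le_trans c0 cr'.
apply: best_gain_le => x.
apply: (@le_trans _ _ (gain r' a nu x + Num.max 0 (nu - a) / c ^+ k * `|r ^+ k - r' ^+ k|));
  last first.
  by rewrite lerD2r; exact: gain_le_best.
rewrite /gain; set m := Num.max x a.
have : Num.max 0 (nu - m) <= Num.max 0 (nu - a).
  by rewrite ge_max !le_max lexx/= lerB ?orbT// le_max lexx orbT.
have : 0 <= Num.max 0 (nu - m) by rewrite le_max lexx.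
set A := Num.max 0 (nu - m); set B := Num.max 0 (nu - a) => A0 AB.
rewrite -lerBlDl -mulrBr -mulrA.
apply: (@le_trans _ _ (A * (`|r ^+ k - r' ^+ k| / c ^+ k))); last first.
  by rewrite [X in B * X]mulrC ler_wpM2r// divr_ge0// exprn_ge0// ltW.
apply: ler_wpM2l => //.
have ck : 0 < c ^+ k by rewrite exprn_gt0.
have [rr|rr] := leP r r'.
  apply: (@le_trans _ _ 0); last by rewrite divr_ge0// ltW.
  rewrite subr_le0; apply: le_expr; first exact: below_max_ge0.
  rewrite /below_max ler_pdivrMr ?lt_max ?r0// mulrAC ler_pdivlMr ?lt_max ?r0'//.
  have [y0|y0] := leP (1 - m) 0.
    by rewrite !max_l ?(mulrC r)//; lra.
  rewrite !maxr_pMr ?(ltW r0) ?(ltW r0')// ge_max !le_max mulrC lexx/=.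
  by rewrite ler_wpM2r ?orbT// ltW.
have M0 : 0 < Num.max r' (1 - m) by rewrite lt_max r0'.
have cM : c <= Num.max r' (1 - m) by rewrite le_max cr'.
have MM : Num.max r' (1 - m) <= Num.max r (1 - m).
  by rewrite ge_max !le_max (ltW rr) lexx orbT.
have rk : r' ^+ k <= r ^+ k by apply: le_expr; exact: ltW.
rewrite /below_max !expr_div_n.
apply: (@le_trans _ _ ((r ^+ k - r' ^+ k) / Num.max r' (1 - m) ^+ k)).
  rewrite mulrBl lerD2r ler_pM2l ?exprn_gt0// lef_pV2 ?posrE ?exprn_gt0//.
    by apply: le_expr => //; exact: ltW.
  exact: lt_le_trans MM.
rewrite ger0_norm ?subr_ge0// ler_wpM2l ?subr_ge0// lef_pV2 ?posrE ?exprn_gt0//.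
by apply: le_expr => //; exact: ltW.
Qed.

(** * Probability of not winning, and the sign of the excess loss *)

Lemma below_min_ge0 r s : r < 1 -> 0 <= below_min r s.
Proof.
move=> r1; rewrite subr_ge0 ler_pdivrMr ?mul1r ?le_max ?lexx ?orbT// lt_max.
by rewrite subr_gt0 r1 orbT.
Qed.

Lemma below_min_lt1 r s : r < 1 -> below_min r s < 1.
Proof.
move=> r1; rewrite ltrBlDr ltrDl divr_gt0// ?lt_max; first lra.
by rewrite subr_gt0 r1 orbT.
Qed.

Lemma below_min0 r s : r < 1 -> s <= 1 - r -> below_min r s = 0.
Proof. by move=> r1 h; rewrite /below_min max_r// divff ?subrr//; lra. Qed.

Lemma below_min_homo r : r < 1 -> {homo below_min r : x y / x <= y}.
Proof.
move=> r1 x y xy; rewrite lerB// ler_pM2l ?subr_gt0// lef_pV2 ?posrE ?lt_max ?subr_gt0 ?r1 ?orbT//.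
by rewrite ge_max !le_max lexx xy orbT.
Qed.

(** Against [k] independent opponents, a bound on the probability that bid [s] does not beat them
    all strictly. *)
Definition lose r s : R := 1 - below_min r s ^+ k.

Lemma lose_gt0 r s : r < 1 -> 0 < lose r s.
Proof.
by move=> r1; rewrite subr_gt0 exprn_ilt1 ?below_min_ge0 ?below_min_lt1// -lt0n.
Qed.

Lemma lose_le1 r s : r < 1 -> lose r s <= 1.
Proof. by move=> r1; rewrite lerBlDr lerDl exprn_ge0// below_min_ge0. Qed.

Lemma lose_nhomo r : r < 1 -> {homo lose r : x y / x <= y >-> y <= x}.
Proof.
move=> r1 x y xy; rewrite lerB//; apply: le_expr; [exact: below_min_ge0|exact: below_min_homo].
Qed.

Lemma lose_ge r s : r < 1 -> 1 - r <= s -> (1 - r) / s <= lose r s.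
Proof.
move=> r1 rs; have s0 : 0 < s by lra.
apply: (@le_trans _ _ (1 - below_min r s)); first by rewrite /below_min max_l//; lra.
by apply: lerB => //; apply: ler_iXnr => //; [exact: below_min_ge0|exact/ltW/below_min_lt1].
Qed.

(* Worst overbidding loss minus worst underbidding loss of bid [s] at value [nu]. *)
Definition excess r nu s : R := best_gain r 0 s - lose r s * best_gain r s nu.

(** The overbidding term strictly increases and the underbidding term decreases, so there is at most
    one nonnegative zero. *)
Lemma excess_lt r nu s s' : 0 < r < 1 -> 0 <= s -> s < s' -> excess r nu s < excess r nu s'.
Proof.
move=> /[dup] r01 /andP[r0 r1] s0 ss.
have := best_gain_lt_r r 0 s s' r01 (lexx _) s0 ss.
have : lose r s' * best_gain r s' nu <= lose r s * best_gain r s nu.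
  apply: ler_pM; rewrite ?best_gain_ge0// ?best_gain_homo_l ?(ltW ss)//.
    by rewrite ltW ?lose_gt0.
  by rewrite lose_nhomo// ltW.
rewrite /excess; lra.
Qed.

(** [best_gain] is a supremum without closed form; this turns its Lipschitz-type estimates into
    continuity. *)
Lemma dominated_continuous (f g : R -> R) x :
  (\forall y \near x, `|f x - f y| <= g y) -> g y @[y --> x] --> 0 ->
  {for x, continuous f}.
Proof.
move=> fg g0; apply/cvgrPdist_le => e e0.
move/cvgrPdist_le : g0 => /(_ e e0) g0; near=> y.
apply: (@le_trans _ _ (g y)); first by near: y.
have : `|0 - g y| <= e by near: y.
by rewrite sub0r normrN; exact/le_trans/ler_norm.
Unshelve. all: by end_near. Qed.

Lemma cvg_distr0 (f : R -> R) x : {for x, continuous f} ->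
  `|f x - f y| @[y --> x] --> 0.
Proof.
move=> fx; rewrite -(normr0 R) -(subrr (f x)); apply: cvg_norm.
by apply: cvgB => //; exact: cvg_cst.
Qed.

Lemma lose_continuous (f g : R -> R) x : {for x, continuous f} -> {for x, continuous g} ->
  f x < 1 -> {for x, continuous (fun y => lose (f y) (g y))}.
Proof.
move=> cf cg fx; apply: cvgB; first exact: cvg_cst.
apply: (@continuous_comp _ _ _ (fun y => below_min (f y) (g y)) (fun z => z ^+ k)).
  apply: cvgB; first exact: cvg_cst.
  have c1f : {for x, continuous (fun y => 1 - f y)} by apply: cvgB => //; exact: cvg_cst.
  apply: cvgM => //; apply: cvgV.
    by rewrite gt_eqF// lt_max subr_gt0 fx orbT.
  exact: (@continuous_max _ _ g (fun y => 1 - f y)).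
exact: exprn_continuous.
Qed.

Lemma best_gain_continuous a (f nu : R -> R) x : {for x, continuous f} ->
  {for x, continuous nu} -> 0 < f x ->
  {for x, continuous (fun y => best_gain (f y) a (nu y))}.
Proof.
(* Near [x] the parameter stays above half its value, which makes one constant [C] serve the whole
   neighbourhood. *)
move=> cf cnu fx; have c0 : 0 < f x / 2 by rewrite divr_gt0.
pose C := Num.max 0 (nu x - a) / (f x / 2) ^+ k.
pose g y := `|nu x - nu y| + C * `|f x ^+ k - f y ^+ k|.
apply: (@dominated_continuous _ g).
  have : \forall y \near x, f x / 2 <= f y.
    have /cvgrPdist_le/(_ _ c0) := cf; apply: filterS => y.
    by move=> /(le_trans (ler_norm _)); lra.
  apply: filterS => y fy; have fy0 := lt_le_trans c0 fy.
  have ffx : f x / 2 <= f x by lra.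
  have := best_gain_Lip_param _ _ _ a (nu x) c0 fy ffx.
  have := best_gain_Lip_param _ _ _ a (nu x) c0 ffx fy.
  have := best_gain_Lip_r (f y) a (nu x) (nu y) fy0.
  have := best_gain_Lip_r (f y) a (nu y) (nu x) fy0.
  rewrite -/C (distrC (nu y)) (distrC (f y ^+ k)) ler_norml /g => H1 H2 H3 H4.
  by apply/andP; split; lra.
rewrite -[X in _ --> X](addr0 0) -[X in 0 + X](mulr0 C).
apply: cvgD; first exact: cvg_distr0.
apply: cvgM; first exact: cvg_cst.
apply: (@cvg_distr0 (fun y => f y ^+ k)).
by apply: (@continuous_comp _ _ _ f (fun z => z ^+ k)) => //; exact: exprn_continuous.
Qed.

Lemma best_gain_continuous_l r nu : 0 < r -> continuous (fun s => best_gain r s nu).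
Proof.
move=> r0 x; apply: (@dominated_continuous _ (fun y => `|x - y|)).
  near=> y; have [xy|yx] := leP x y.
    have := best_gain_Lip_l r x y nu r0 xy.
    have := best_gain_homo_l r x y nu r0 xy => H1 H2.
    by rewrite ger0_norm ?subr_ge0// distrC ger0_norm ?subr_ge0//; lra.
  have := best_gain_Lip_l r y x nu r0 (ltW yx).
  have := best_gain_homo_l r y x nu r0 (ltW yx) => H1 H2.
  by rewrite distrC ger0_norm ?subr_ge0// ger0_norm ?subr_ge0 ?(ltW yx)//; lra.
exact: (@cvg_distr0 id).
Unshelve. all: by end_near. Qed.

Lemma excess_continuous r nu : 0 < r < 1 -> continuous (excess r nu).
Proof.
move=> /andP[r0 r1] x; apply: cvgB.
  by apply: (@best_gain_continuous 0 (cst r) id) => //; exact: cvg_cst.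
apply: cvgM; last exact: best_gain_continuous_l.
by apply: (@lose_continuous (cst r) id) => //; exact: cvg_cst.
Qed.

Lemma excess_continuous_param s (nu : R -> R) r : 0 < r < 1 -> {for r, continuous nu} ->
  {for r, continuous (fun r => excess r (nu r) s)}.
Proof.
move=> /andP[r0 r1] cnu; apply: cvgB.
  by apply: (@best_gain_continuous 0 id (cst s)) => //; exact: cvg_cst.
apply: cvgM; first by apply: (@lose_continuous id (cst s)) => //; exact: cvg_cst.
exact: (@best_gain_continuous s id nu).
Qed.

(** For [0 < r < 1] and [0 <= nu] the zero exists and is unique, so the default [0] is not taken. *)
Definition norm_bid r nu : R := xget 0 [set s | 0 <= s <= nu /\ excess r nu s = 0].

(** A bid of [0] has no overbidding loss and a bid equal to the value has no underbidding loss, so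
    the excess changes sign on [[0, nu]]. *)
Lemma norm_bidP r nu : 0 < r < 1 -> 0 <= nu ->
  0 <= norm_bid r nu <= nu /\ excess r nu (norm_bid r nu) = 0.
Proof.
move=> /[dup] r01 /andP[r0 r1] nu0.
suff [s Ps] : exists s, 0 <= s <= nu /\ excess r nu s = 0.
  by rewrite /norm_bid; case: xgetP => // /(_ s).
have e0 : excess r nu 0 <= 0.
  rewrite /excess best_gain0// sub0r oppr_le0 mulr_ge0 ?best_gain_ge0//.
  by rewrite ltW ?lose_gt0.
have e1 : 0 <= excess r nu nu.
  by rewrite /excess (best_gain0 r nu nu r0 (lexx _)) mulr0 subr0 best_gain_ge0.
have ce := continuous_subspaceT (excess_continuous r nu r01).
have [|s sI se] := @IVT _ (excess r nu) 0 nu 0 nu0 (ce _).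
  by rewrite ge_min le_max e0 e1 orbT.
by exists s; move: sI; rewrite in_itv.
Qed.

Lemma norm_bid_gt r nu s : 0 < r < 1 -> 0 <= nu -> excess r nu s < 0 -> s < norm_bid r nu.
Proof.
move=> r01 nu0 es; have [/andP[b0 bn] be] := norm_bidP r nu r01 nu0.
rewrite ltNge; apply/negP; rewrite le_eqVlt => /predU1P[bs|bs].
  by move: es; rewrite -bs be ltxx.
by have := excess_lt r nu _ _ r01 b0 bs; rewrite be => /lt_trans/(_ es); rewrite ltxx.
Qed.

Lemma norm_bid_le r nu s : 0 < r < 1 -> 0 <= nu -> 0 <= s -> 0 <= excess r nu s ->
  norm_bid r nu <= s.
Proof.
move=> r01 nu0 s0 es; have [/andP[b0 bn] be] := norm_bidP r nu r01 nu0.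
rewrite leNgt; apply/negP => bs.
by have := excess_lt r nu _ _ r01 s0 bs; rewrite be ltNge es.
Qed.

(** At the bid balanced for [nu], a larger value strictly raises the underbidding loss, which makes
    the excess negative there. *)
Lemma norm_bid_lt r nu nu' : 0 < r < 1 -> 0 <= nu -> nu < nu' ->
  norm_bid r nu < norm_bid r nu'.
Proof.
move=> /[dup] r01 /andP[r0 r1] nu0 nn; have [/andP[b0 bn] be] := norm_bidP r nu r01 nu0.
apply: norm_bid_gt => //; first by lra.
have := best_gain_lt_r r _ nu nu' r01 b0 bn nn.
rewrite -(ltr_pM2l (lose_gt0 r (norm_bid r nu) r1)).
by move: be; rewrite /excess; lra.
Qed.

(** The excess has strict signs at the fixed bids [b - e] and [b + e]; these persist for nearby
    parameters and trap the balanced bid. *)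
Lemma norm_bid_continuous (nu : R -> R) r : 0 < r < 1 -> {for r, continuous nu} ->
  (forall x, 0 < x < 1 -> 0 <= nu x) -> {for r, continuous (fun r => norm_bid r (nu r))}.
Proof.
move=> r01 cnu nu0; apply/cvgrPdist_le => e e0.
have [/andP[b0 bn] be] := norm_bidP r (nu r) r01 (nu0 _ r01).
set b := norm_bid r (nu r) in b0 bn be *.
have r01near : \forall x \near r, 0 < x < 1.
  have := @near_in_itvoo R 0 1 r; rewrite in_itv/= => /(_ r01).
  by apply: filterS => x; rewrite in_itv.
have up : \forall x \near r, 0 < excess x (nu x) (b + e).
  have /cvgr_gt := excess_continuous_param (b + e) nu r r01 cnu; apply.
  by rewrite -be; apply: excess_lt => //; lra.
(* Strict monotonicity is available on nonnegative bids only; for negative [b - e] the lower bound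
   is trivial. *)
have dn : \forall x \near r, b - e < 0 \/ excess x (nu x) (b - e) < 0.
  have [h|h] := ltP (b - e) 0; first by near=> x; left.
  have : \forall x \near r, excess x (nu x) (b - e) < 0.
    have /cvgr_lt := excess_continuous_param (b - e) nu r r01 cnu; apply.
    by rewrite -be; apply: excess_lt => //; lra.
  by apply: filterS => x; right.
near=> x; have x01 : 0 < x < 1 by near: x.
have [/andP[x0 _] _] := norm_bidP x (nu x) x01 (nu0 _ x01).
have : norm_bid x (nu x) <= b + e.
  by apply: norm_bid_le => //; [exact: nu0|lra|apply: ltW; near: x].
have : b - e <= norm_bid x (nu x).
  have [h|h] : b - e < 0 \/ excess x (nu x) (b - e) < 0 by near: x.
    by rewrite (le_trans (ltW h)).
  by apply: ltW; apply: norm_bid_gt => //; exact: nu0.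
by rewrite ler_norml => ? ?; apply/andP; split; lra.
Unshelve. all: by end_near. Qed.

(** Any bid beyond [1 - r] can be lowered to [1 - r], and one with no margin can be replaced by [a].
    Within [[a, 1 - r]] two-point opponent bids attain [below_max]. *)
Lemma best_gain_approx r a nu e : 0 < r -> a <= nu -> a <= 1 - r -> 0 < e ->
  exists2 x, a <= x <= 1 - r & best_gain r a nu - e < (nu - x) * below_max r x ^+ k.
Proof.
move=> r0 an ar e0; have [y ye] := best_gain_adherent r a nu e r0 e0.
move: ye; rewrite /gain; set m := Num.max y a => ye.
have am : a <= m by rewrite le_max lexx orbT.
have /andP[h0 h1] := expr_below_max r m r0.
have [nm|mn] := leP nu m.
  exists a; first by rewrite lexx.
  apply: (lt_le_trans ye); rewrite max_l ?subr_le0// mul0r.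
  by rewrite mulr_ge0 ?subr_ge0// exprn_ge0// below_max_ge0.
rewrite max_r ?subr_ge0 ?(ltW mn)// in ye.
have [mr|rm] := leP m (1 - r); first by exists m; rewrite ?am.
exists (1 - r); first by rewrite ar lexx.
apply: (lt_le_trans ye); rewrite (below_max1 r (1 - r))// expr1n mulr1.
by apply: (@le_trans _ _ (nu - m)); [rewrite ler_piMr//|]; lra.
Qed.

(** Since [below_max ^+ k <= below_max], the gain at [x < 1 - r] is at most
    [(1 - x) * (r / (1 - x)) = r], which [x = 1 - r] attains. *)
Lemma best_gain01 r : 0 < r < 1 -> best_gain r 0 1 = r.
Proof.
move=> /andP[r0 r1]; apply/eqP; rewrite eq_le; apply/andP; split; last first.
  have r1' : 0 <= 1 - r by lra.
  by have := best_gain_term r 0 1 (1 - r) r0 r1'; rewrite below_max1// expr1n mulr1; lra.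
apply: best_gain_le => x; rewrite /gain; set m := Num.max x 0.
have /andP[h0 h1] := expr_below_max r m r0.
have [rm|mr] := leP (1 - r) m.
  apply: (@le_trans _ _ (Num.max 0 (1 - m))); first by rewrite ler_piMr// le_max lexx.
  by rewrite ge_max (ltW r0)/=; lra.
have m1 : 0 < 1 - m by lra.
rewrite max_r ?(ltW m1)//.
apply: (@le_trans _ _ ((1 - m) * below_max r m)).
  by rewrite ler_pM2l//; apply: ler_iXnr => //; [exact: below_max_ge0|exact: below_max_le1].
by rewrite /below_max max_r; [rewrite mulrC divfK// gt_eqF|lra].
Qed.

(* The value at which the minimax-loss bid is the upper end [1] of the bid range. *)
Definition top_value r : R := 1 + r / (1 - r ^+ k).

Lemma expr_gt0_lt1 r : 0 < r < 1 -> 0 < r ^+ k < 1.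
Proof. by move=> /andP[r0 r1]; rewrite exprn_gt0// exprn_ilt1// ?ltW// -lt0n. Qed.

Lemma top_value_ge1 r : 0 < r < 1 -> 1 <= top_value r.
Proof.
move=> /[dup] /expr_gt0_lt1 /andP[? ?] /andP[? ?].
by rewrite lerDl divr_ge0//; lra.
Qed.

(** At [s = 1] the overbidding part and [below_min] both equal [r], so the balance reads
    [r = (1 - r ^+ k) * (nu - 1)], which [top_value] solves. *)
Lemma norm_bid_top r : 0 < r < 1 -> norm_bid r (top_value r) = 1.
Proof.
move=> /[dup] r01 /andP[r0 r1]; have /andP[rk0 rk1] := expr_gt0_lt1 r r01.
have t1 := top_value_ge1 r r01.
have t0 : 0 <= top_value r by lra.
have e1 : excess r (top_value r) 1 = 0.
  rewrite /excess best_gain01// best_gain_above//; last by lra.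
  rewrite max_r ?subr_ge0// /lose /below_min max_l; last by lra.
  by rewrite divr1 subKr /top_value; field; lra.
apply/eqP; rewrite eq_le norm_bid_le// ?e1//=.
rewrite leNgt; apply/negP => b1; have [/andP[b0 _] be] := norm_bidP r _ r01 t0.
by have := excess_lt r (top_value r) _ _ r01 b0 b1; rewrite be e1 ltxx.
Qed.

Lemma one_sub_expr_le r : 0 <= r <= 1 -> 1 - r ^+ k <= k%:R * (1 - r).
Proof.
move=> /andP[r0 r1]; elim: (k) => [|j IH]; first by rewrite expr0 subrr mul0r.
have rj : r ^+ j <= 1 by exact: exprn_ile1.
have : r ^+ j * (1 - r) <= 1 * (1 - r) by rewrite ler_wpM2r//; lra.
rewrite exprSr -natr1; lra.
Qed.

(** At bid [s = 1 / (4 k)] overbidding loses at most [s <= 1/4], while underbidding loses at least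
    [(1 - r) / s * (r / (k * (1 - r)) / 2) = 2 * r >= 1]. The factors [1 - r] cancel, so the bound
    survives as [r] tends to [1]. *)
Lemma norm_bid_ge r nu : 2^-1 <= r < 1 -> 1 - r <= (4 * k%:R)^-1 ->
  top_value r / 2 <= nu -> (4 * k%:R)^-1 <= norm_bid r nu.
Proof.
move=> /andP[r0 r1] rs hnu.
have r01 : 0 < r < 1 by apply/andP; split; lra.
have k1 : 1 <= k%:R :> R by rewrite ler1n.
have /andP[rk0 rk1] := expr_gt0_lt1 r r01.
have r01' : 0 <= r <= 1 by apply/andP; split; lra.
have rk := one_sub_expr_le r r01'.
set s := (4 * k%:R)^-1 in rs *.
have sE : s = (k%:R)^-1 / 4 by rewrite /s invfM mulrC.
have sk : (k%:R) * s = 4^-1 by rewrite sE; field; lra.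
have s0 : 0 < s by rewrite invr_gt0; lra.
have s1 : s <= 4^-1 by rewrite -sk ler_peMl// ltW.
have nu1 : r / (k%:R * (1 - r)) / 2 <= nu - s.
  have : r / (k%:R * (1 - r)) <= r / (1 - r ^+ k).
    have D1 : 0 < 1 - r ^+ k by lra.
    have D2 : 0 < k%:R * (1 - r) by lra.
    by rewrite ler_pM2l ?lef_pV2 ?posrE//; lra.
  by move: hnu; rewrite /top_value; lra.
have nu0 : 0 <= nu - s.
  apply: le_trans nu1; rewrite divr_ge0// divr_ge0//; first by lra.
  by rewrite mulr_ge0; lra.
apply: ltW; apply: norm_bid_gt => //; first by lra.
have /andP[r0' _] := r01.
have b1 : best_gain r 0 s <= s.
  by rewrite (le_trans (best_gain_ub _ _ _ r0'))// subr0 ge_max lexx ltW.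
have b2 : best_gain r s nu = nu - s by rewrite best_gain_above// max_r.
have l1 := lose_ge r s r1 rs.
have : (1 - r) / s * (r / (k%:R * (1 - r)) / 2) <= lose r s * (nu - s).
  by apply: ler_pM => //; rewrite divr_ge0 ?divr_ge0 ?mulr_ge0//; lra.
have -> : (1 - r) / s * (r / (k%:R * (1 - r)) / 2) = 2 * r.
  have -> : s^-1 = 4 * k%:R by rewrite /s invrK.
  by field; apply/andP; split; lra.
rewrite /excess b2; lra.
Qed.

End normalised_bid.

(** * Opponents' bids with given range and mean *)

Section opponents.
Context {R : realType}.
Implicit Types (B : probability R R) (l mu u v b x y p : R).

(** * Probabilities as real numbers and two-point laws *)

Lemma prE B (A : set R) : measurable A -> (pr B A)%:E = B A.
Proof. by move=> mA; rewrite fineK// fin_num_measure. Qed.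

Lemma pr_ge0 B (A : set R) : 0 <= pr B A.
Proof. by rewrite fine_ge0. Qed.

Lemma pr_le B (A C : set R) : measurable A -> measurable C -> A `<=` C -> pr B A <= pr B C.
Proof. by move=> mA mC AC; rewrite -lee_fin !prE// le_measure// inE. Qed.

Lemma pr_le1 B (A : set R) : measurable A -> pr B A <= 1.
Proof. by move=> mA; rewrite -lee_fin prE// probability_le1. Qed.

Lemma measurable_lt b : measurable [set x | x < b].
Proof. by rewrite -set_itvNyo; exact: measurable_itv. Qed.

Lemma measurable_le b : measurable [set x | x <= b].
Proof. by rewrite -set_itvNyc; exact: measurable_itv. Qed.
Hint Resolve measurable_lt measurable_le : core.

Lemma pr_point_lt B b : pr B [set b] + pr B [set x | x < b] = pr B [set x | x <= b].
Proof.
apply: EFin_inj; rewrite EFinD !prE// -measureU//.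
- congr (B _); apply/seteqP; split=> x /=; rewrite le_eqVlt.
    by move=> [->|->]; rewrite ?eqxx ?orbT.
  by move=> /predU1P[]; [left|right].
- by apply/seteqP; split=> x//= [->]; rewrite ltxx.
Qed.

(** The law is the image of a Bernoulli law under the map sending [true] to [x] and [false] to
    [y]. *)
Lemma two_point_probability p x y : 0 <= p <= 1 -> 0 <= x -> 0 <= y ->
  exists B, (forall A : set R, measurable A ->
      pr B A = p * (x \in A)%:R + (1 - p) * (y \in A)%:R) /\
    (\int[B]_z z%:E = (p * x + (1 - p) * y)%:E)%E.
Proof.
move=> p01 x0 y0.
pose f (c : bool) : R := if c then x else y.
have mf : measurable_fun setT f by [].
pose X : {mfun bool >-> R} := HB.pack f (isMeasurableFun.Build _ _ _ _ f mf).
exists (distribution (bernoulli_prob p) X); split.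
  move=> A mA; apply: EFin_inj; rewrite prE//.
  transitivity (bernoulli_prob p (f @^-1` A)); first by [].
  by rewrite bernoulli_probE// EFinD !EFinM.
rewrite /distribution integral_pushforward//=.
- rewrite preimage_setT (integral_bernoulli_prob p01 (f := fun c => (f c)%:E))//=.
  by case; rewrite lee_fin.
- rewrite preimage_setT.
  apply: (@measurable_bounded_integrable _ _ _ _ f) => //.
    by rewrite (le_lt_trans (probability_le1 _ _))// ltry.
  exists (x + y); split; first exact: num_real.
  by move=> M hM [] _ /=; rewrite /f ger0_norm//; lra.
Qed.

Lemma pr_setC B (A : set R) : measurable A -> pr B (~` A) = 1 - pr B A.
Proof.
move=> mA; apply: EFin_inj; rewrite EFinB !prE ?probability_setC//.
exact: measurableC.
Qed.

(** * Markov bounds from range and mean, and laws attaining them *)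

Lemma belief_null l mu u B : belief l mu u B -> B (~` `[l, u]) = 0%E.
Proof. by move=> [_ [B1 _]]; rewrite probability_setC// B1 subee. Qed.

Lemma integral_belief l mu u B : belief l mu u B -> (\int[B]_(z in `[l, u]) z%:E = mu%:E)%E.
Proof.
move=> Bb; have C0 := belief_null _ _ _ _ Bb; case: Bb => _ [_ <-].
rewrite integral_mkcond.
transitivity (\int[B]_z (z * \1_(`[l, u] : set R) z)%:E)%E.
  apply: eq_integral => z _; rewrite patchE indicE.
  by case: ifPn; rewrite ?mulr1 ?mulr0.
apply: ae_eq_integral => //.
  by apply/measurable_EFinP; apply: measurable_funM => //; exact: measurable_indic.
exists (~` `[l, u]); split => //; first exact: measurableC.
by move=> z /= H; apply: contra_not H => zlu _; rewrite indicE mem_set// mulr1.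
Qed.

(** Each Markov-type estimate integrates a pointwise comparison with such a step function over a set
    of full measure. *)
Lemma integral_step B (D A : set R) a c : measurable D -> B D = 1%E -> measurable A ->
  0 <= a -> 0 <= c -> (\int[B]_(z in D) (a + c * \1_A z)%:E = (a + c * pr B A)%:E)%E.
Proof.
move=> mD B1 mA a0 c0; have C0 : B (~` D) = 0%E by rewrite probability_setC// B1 subee.
under eq_integral do rewrite EFinD.
rewrite ge0_integralD//; last 2 first.
- by move=> z _; rewrite lee_fin mulr_ge0.
- by apply/measurable_EFinP; apply: measurable_funM => //; exact: measurable_indic.
rewrite integral_cst// EFinD.
congr (_ + _)%E; first by rewrite [X in (_ * X)%E]B1 mule1.
under eq_integral do rewrite EFinM.
rewrite ge0_integralZl//; last first.
- by apply/measurable_EFinP; exact: measurable_indic.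
rewrite EFinM integral_indic// prE//; congr (_ * _)%E.
rewrite [RHS](@measureDI _ _ _ B A D)//.
rewrite [X in _ = (X + _)%E](_ : _ = 0%E) ?add0e//.
by apply: (subset_measure0 (B := ~` D) _ _ _ C0);
  [exact: measurableD|exact: measurableC|move=> z []].
Qed.

(** Markov's inequality for [u - z]: on the range, [z] is at most [x], plus [u - x] where
    [z > x]. *)
Lemma belief_pr_le l mu u B x : belief l mu u B -> 0 <= l -> l <= x -> x < u ->
  pr B [set z | z <= x] <= (u - mu) / (u - x).
Proof.
move=> Bb l0 lx xu; rewrite ler_pdivlMr ?subr_gt0//.
have : (mu%:E <= (x + (u - x) * pr B (~` [set z | z <= x]))%:E)%E.
  rewrite -(integral_belief _ _ _ _ Bb) -(integral_step B `[l, u] _ x (u - x))//; first last.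
  - lra.
  - lra.
  - exact: measurableC.
  - by case: Bb => _ [].
  apply: ge0_le_integral => //.
  - by move=> z /=; rewrite in_itv/= lee_fin => /andP[? _]; lra.
  - apply/measurable_EFinP; apply: measurable_funD => //; apply: measurable_funM => //.
    by apply: measurable_indic; exact: measurableC.
  - move=> z /=; rewrite in_itv/= lee_fin indicE => /andP[lz zu].
    have [zx|xz] := leP z x; first by rewrite memNset ?mulr0 ?addr0//= => /(_ zx).
    by rewrite mem_set ?mulr1/=; [lra|apply/negP; rewrite -ltNge].
by rewrite lee_fin pr_setC//; lra.
Qed.

(** Markov's inequality for [z - l]: on the range, [z] is at least [l], plus [b - l] where
    [z >= b]. *)
Lemma belief_pr_lt_ge l mu u B b : belief l mu u B -> 0 <= l -> l < b ->
  (b - mu) / (b - l) <= pr B [set z | z < b].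
Proof.
move=> Bb l0 lb; rewrite ler_pdivrMr ?subr_gt0//.
have : ((l + (b - l) * pr B (~` [set z | z < b]))%:E <= mu%:E)%E.
  rewrite -(integral_belief _ _ _ _ Bb) -(integral_step B `[l, u] _ l (b - l))//; first last.
  - lra.
  - exact: measurableC.
  - by case: Bb => _ [].
  apply: ge0_le_integral => //.
  - by move=> z _; rewrite lee_fin addr_ge0 ?mulr_ge0//; lra.
  - apply/measurable_EFinP; apply: measurable_funD => //; apply: measurable_funM => //.
    by apply: measurable_indic; exact: measurableC.
  - move=> z /=; rewrite in_itv/= lee_fin indicE => /andP[lz zu].
    have [bz|zb] := leP b z; last by rewrite memNset ?mulr0 ?addr0//= => /(_ zb).
    by rewrite mem_set ?mulr1/=; [lra|apply/negP; rewrite -leNgt].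
by rewrite lee_fin pr_setC//; lra.
Qed.

Lemma belief_pr_le0 l mu u B x : belief l mu u B -> x < l -> pr B [set z | z <= x] = 0.
Proof.
move=> Bb xl; apply: EFin_inj; rewrite prE//.
apply: (subset_measure0 (B := ~` `[l, u]) _ _ _ (belief_null _ _ _ _ Bb));
  [by []|exact: measurableC|].
by move=> z /= zx; rewrite in_itv/= => /andP[lz _]; move: (le_lt_trans zx xl); rewrite ltNge lz.
Qed.

(** The weights are the only ones on [x] and [y] with mean [mu]. *)
Lemma belief_two_point l mu u x y : 0 <= l -> l <= x -> x <= mu -> mu <= y -> y <= u -> x < y ->
  exists2 B, belief l mu u B & forall A : set R, measurable A ->
    pr B A = (y - mu) / (y - x) * (x \in A)%:R + (mu - x) / (y - x) * (y \in A)%:R.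
Proof.
move=> l0 lx xm my yu xy.
have p01 : 0 <= (y - mu) / (y - x) <= 1.
  by rewrite divr_ge0 ?ler_pdivrMr ?mul1r//; lra.
have [|| B [BE Bint]] := two_point_probability _ x y p01; [lra|lra|].
have pE : 1 - (y - mu) / (y - x) = (mu - x) / (y - x) by field; lra.
have B1 A : measurable A -> x \in A -> y \in A -> B A = 1%E.
  by move=> mA xA yA; rewrite -prE// BE// xA yA !mulr1; congr (_%:E); lra.
exists B; last by move=> A mA; rewrite BE// pE.
split; [|split].
- by apply: B1 => //; rewrite inE/= in_itv/= andbT; lra.
- by apply: B1 => //; rewrite inE/= in_itv/=; lra.
- by rewrite Bint; congr (_%:E); field; lra.
Qed.

(** * Bounds on win probability, payoff and loss *)

Section win_share.
Context {n : nat} (i : 'I_n).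
Implicit Type Bs : 'I_n -> probability R R.

Lemma exists_opponent : (1 < n)%N -> exists j : 'I_n, j != i.
Proof.
move=> n_gt1; have : (0 < #|predC1 i|)%N by rewrite cardC1 card_ord; case: (n) n_gt1 => [|[]].
by move/card_gt0P => [j ji]; exists j.
Qed.

Lemma win_share_ge Bs b : \prod_(j | j != i) pr (Bs j) [set x | x < b] <= win_share i Bs b.
Proof.
rewrite /win_share (bigD1 (finset.set0 : {set 'I_n}))/=; last first.
  by apply/fintype.subsetP => j; rewrite inE.
rewrite big_set0 mul1r cards0 divr1.
rewrite [in leRHS](eq_bigl (fun j => j != i)); last by move=> j; rewrite !inE.
rewrite lerDl sumr_ge0// => T _; rewrite divr_ge0// mulr_ge0// prodr_ge0// => j _; exact: pr_ge0.
Qed.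

(** Without the tie-breaking divisor, the sum over tie sets is the expansion of the product of the
    sums P(bid = b) + P(bid < b). *)
Lemma win_share_le Bs b : win_share i Bs b <= \prod_(j | j != i) pr (Bs j) [set x | x <= b].
Proof.
(* The values [0] and [1] at index [i] let the product run over all bidders: tie sets containing [i]
   contribute [0]. *)
pose F j := if j == i then 0 else pr (Bs j) [set b].
pose G j := if j == i then 1 else pr (Bs j) [set x | x < b].
have -> : \prod_(j | j != i) pr (Bs j) [set x | x <= b] = \prod_j (F j + G j).
  rewrite [RHS](bigD1 i)//= /F /G eqxx add0r mul1r.
  by apply: eq_bigr => j /negPf ->; rewrite pr_point_lt.
rewrite bigA_distr /win_share [leRHS](bigID (fun T : {set 'I_n} => i \notin T))/=.
rewrite [X in _ + X]big1 ?addr0; last first.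
  move=> T; rewrite negbK => iT; rewrite (bigD1 i)//= iT /F eqxx mul0r//.
rewrite [leLHS](eq_bigl (fun T : {set 'I_n} => i \notin T)); last first.
  move=> T; apply/fintype.subsetP/idP.
    by move=> H; apply/negP => /H; rewrite !inE/=; apply.
  by move=> iT j jT; rewrite !inE/= => ji; move: iT; rewrite -ji jT.
apply: ler_sum => T iT.
have -> : \prod_j (if j \in T then F j else G j) =
  (\prod_(j in T) pr (Bs j) [set b]) * \prod_(j in [set~ i]%SET :\: T) pr (Bs j) [set x | x < b].
  rewrite (bigID (fun j => j \in T))/=; congr (_ * _).
    by apply: eq_bigr => j jT; rewrite jT /F ifN//; apply: contraNneq iT => <-.
  rewrite (bigD1 i)//= (negPf iT) /G eqxx mul1r.
  apply: eq_big => [j|j /andP[/negPf -> /negPf ->]//].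
  by rewrite !inE.
rewrite ler_pdivrMr ?ltr0n// ler_peMr ?ler1n// mulr_ge0// prodr_ge0// => j _; exact: pr_ge0.
Qed.

Lemma loss_le v Bs b c : (forall b', 0 <= b' -> payoff i v Bs b' - payoff i v Bs b <= c) ->
  (loss i v Bs b <= c%:E)%E.
Proof.
move=> H; rewrite /loss leeBlDr// -EFinD; apply: ge_ereal_sup => _ [b' b'0 <-].
by rewrite lee_fin; have := H b' b'0; lra.
Qed.

Lemma loss_ge v Bs b b' c : 0 <= b' -> payoff i v Bs b <= c ->
  ((payoff i v Bs b' - c)%:E <= loss i v Bs b)%E.
Proof.
move=> b'0 bc; rewrite /loss leeBrDr// -EFinD.
apply: (@le_trans _ _ (payoff i v Bs b')%:E); first by rewrite lee_fin; lra.
by apply: ereal_sup_ubound; exists b'.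
Qed.

Lemma payoff_le v Bs b : b <= v ->
  payoff i v Bs b <= (v - b) * \prod_(j | j != i) pr (Bs j) [set x | x <= b].
Proof. by move=> bv; rewrite ler_wpM2l ?win_share_le// subr_ge0. Qed.

Lemma payoff_ge v Bs b : b <= v ->
  (v - b) * \prod_(j | j != i) pr (Bs j) [set x | x < b] <= payoff i v Bs b.
Proof. by move=> bv; rewrite ler_wpM2l ?win_share_ge// subr_ge0. Qed.

Lemma win_share_ge0 Bs b : 0 <= win_share i Bs b.
Proof. by apply: le_trans (win_share_ge Bs b); apply: prodr_ge0 => j _; exact: pr_ge0. Qed.

Lemma payoff_le0 v Bs b : v <= b -> payoff i v Bs b <= 0.
Proof. by move=> vb; rewrite mulr_le0_ge0 ?win_share_ge0// subr_le0. Qed.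

(* Bidding slightly above [x] beats every opponent bid that is at most [x]. *)
Lemma loss_ge_limit v Bs b x c : 0 <= v -> 0 <= x -> payoff i v Bs b <= c ->
  (((v - x) * \prod_(j | j != i) pr (Bs j) [set z | z <= x] - c)%:E <= loss i v Bs b)%E.
Proof.
move=> v0 x0 bc; set P := \prod_(_ | _) _.
have P01 : 0 <= P <= 1.
  rewrite prodr_ge0/=; last by move=> j _; exact: pr_ge0.
  by apply: prodr_ile1 => j _; rewrite pr_ge0 pr_le1.
have /andP[P0 P1] := P01.
have [vx|xv] := leP v x.
  apply: (le_trans _ (loss_ge v Bs b v c v0 bc)); rewrite lee_fin lerD2r.
  by rewrite /payoff subrr mul0r mulr_le0_ge0// subr_le0.
apply/lee_addgt0Pr => e e0.
(* The increment costs at most [e] and keeps the deviating bid at most [v], so its margin is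
   nonnegative. *)
pose d := Num.min e (v - x).
have d0 : 0 < d by rewrite lt_min e0 subr_gt0.
have de : d <= e by rewrite ge_min lexx.
have dv : d <= v - x by rewrite ge_min lexx orbT.
have xd0 : 0 <= x + d by lra.
rewrite -leeBlDr//; apply: (le_trans _ (loss_ge v Bs b _ c xd0 bc)).
rewrite -EFinB lee_fin.
have := payoff_ge v Bs (x + d); rewrite -lerBrDl => /(_ dv).
have : (v - (x + d)) * P <= (v - (x + d)) * \prod_(j | j != i) pr (Bs j) [set z | z < x + d].
  apply: ler_wpM2l; first by lra.
  apply: ler_prod => j _; rewrite pr_ge0/= pr_le// => z/= zx.
  by rewrite (le_lt_trans zx)// ltrDl.
have : d * P <= d * 1 by rewrite ler_pM2l.
lra.
Qed.

End win_share.
End opponents.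

(** * Minimaxity of the loss-equalizing bid *)

Section minimax.
Context {R : realType} {n : nat} (i : 'I_n) (l t r nu s : R).
Hypotheses (n_gt1 : (1 < n)%N) (l_ge0 : 0 <= l) (t_gt0 : 0 < t) (r01 : 0 < r < 1).
Let k := n.-1.
Hypotheses (s_ge0 : 0 <= s) (s_le1 : s <= 1) (s_le_nu : s <= nu).
Hypothesis s_balanced : excess k r nu s = 0.
Let mu := l + t * (1 - r).
Let u := l + t.
Let v := l + t * nu.
Let b := l + t * s.

Let k_gt0 : (0 < k)%N. Proof. by rewrite /k; case: (n) n_gt1 => [|[]]. Qed.

Let r_gt0 : 0 < r. Proof. by case/andP: r01. Qed.
Let r_lt1 : r < 1. Proof. by case/andP: r01. Qed.
Let balance : best_gain k r 0 s = lose k r s * best_gain k r s nu.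
Proof. by move/eqP: s_balanced; rewrite subr_eq0 => /eqP. Qed.
Let bounds : [/\ 0 < r, r < 1, 0 <= l & 0 < t] /\ [/\ 0 <= s, s <= 1 & s <= nu].
Proof. by []. Qed.
Let nu_ge0 : 0 <= nu. Proof. exact: le_trans s_le_nu. Qed.
Let v_ge0 : 0 <= v. Proof. by rewrite addr_ge0// mulr_ge0// ltW. Qed.
Let ts_gt : 1 - r < s -> 0 < t * s /\ 0 < t * (s - (1 - r)).
Proof.
have [[hr0 hr1 hl ht] [hs0 hs1 hsn]] := bounds.
by move=> rs; split; rewrite mulr_gt0//; lra.
Qed.
Let trK z : l + t * ((z - l) / t) = z.
Proof. by rewrite [t * _]mulrC divfK ?gt_eqF//; lra. Qed.

Let prod_opponents (c : R) : \prod_(j < n | j != i) c = c ^+ k.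
Proof.
rewrite prodr_const; congr (_ ^+ _).
by transitivity #|predC1 i|; [exact: eq_card|rewrite cardC1 card_ord].
Qed.

(** * Upper bound on the worst loss of the balanced bid *)

Lemma belief_below_max B x : belief l mu u B -> 0 <= x ->
  pr B [set z | z <= l + t * x] <= below_max r x.
Proof.
have [[hr0 hr1 hl ht] [hs0 hs1 hsn]] := bounds.
move=> Bb x0; have [xr|rx] := leP (1 - r) x.
  by rewrite below_max1// pr_le1//; exact: measurable_le.
have tx : 0 < t * (1 - x) by rewrite mulr_gt0//; lra.
have tr : 0 < t * r by rewrite mulr_gt0.
have -> : below_max r x = (u - mu) / (u - (l + t * x)).
  rewrite /below_max max_r; last by lra.
  by rewrite /u /mu; field; apply/andP; split; lra.
apply: (belief_pr_le _ _ _ _ _ Bb) => //; last by rewrite /u; lra.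
by rewrite lerDl mulr_ge0// ltW.
Qed.

Lemma belief_below_min B : belief l mu u B -> below_min r s <= pr B [set z | z < b].
Proof.
have [[hr0 hr1 hl ht] [hs0 hs1 hsn]] := bounds.
move=> Bb; have [sr|rs] := leP s (1 - r); first by rewrite below_min0// pr_ge0.
have [ts tsr] := ts_gt rs.
have -> : below_min r s = (b - mu) / (b - l).
  rewrite /below_min max_l ?(ltW rs)// /b /mu; field.
  by apply/andP; split; lra.
by apply: belief_pr_lt_ge Bb _ _ => //; rewrite /b; lra.
Qed.

(** Deviations to at least [v] or to below [l] earn at most [0]. Upward deviations are bounded by
    the underbidding part, downward ones by the overbidding part, and the two parts are equal. *)
Lemma worst_loss_norm_bid_le :
  (worst_loss i l mu u v b <= (t * best_gain k r 0 s)%:E)%E.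
Proof.
have [[hr0 hr1 hl ht] [hs0 hs1 hsn]] := bounds.
have C0 : 0 <= t * best_gain k r 0 s by rewrite mulr_ge0 ?best_gain_ge0// ltW.
have bv : b <= v by rewrite lerD2l ler_pM2l.
apply: ge_ereal_sup => _ [Bs Bb <-]; apply: loss_le => b' b'0.
have pb0 : 0 <= payoff i v Bs b by rewrite mulr_ge0 ?win_share_ge0// subr_ge0.
have [vb'|b'v] := leP v b'; first by have := payoff_le0 i v Bs b' vb'; lra.
have pb' := payoff_le i v Bs b' (ltW b'v).
have pb := payoff_ge i v Bs b bv.
have [lb'|b'l] := leP l b'; last first.
  have [j ji] := exists_opponent i n_gt1.
  move: pb'; rewrite (bigD1 j)//= (belief_pr_le0 _ _ _ _ _ (Bb j ji) b'l) mul0r mulr0; lra.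
set x := (b' - l) / t.
have x0 : 0 <= x by rewrite divr_ge0 ?subr_ge0// ltW.
have b'E : b' = l + t * x by rewrite trK.
have Pe : \prod_(j < n | j != i) pr (Bs j) [set z | z <= b'] <= below_max r x ^+ k.
  rewrite -prod_opponents; apply: ler_prod => j ji.
  by rewrite pr_ge0/= b'E; apply: belief_below_max => //; exact: Bb.
have [bb'|b'b] := leP b b'.
  have Qe : below_min r s ^+ k <= \prod_(j < n | j != i) pr (Bs j) [set z | z < b].
    rewrite -prod_opponents; apply: ler_prod => j ji.
    by rewrite below_min_ge0//; apply: belief_below_min; exact: Bb.
  apply: (@le_trans _ _ ((v - b') * below_max r x ^+ k - (v - b) * below_min r s ^+ k)).
    apply: lerB.
      by apply: (le_trans pb'); rewrite ler_wpM2l// subr_ge0 ltW.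
    by apply: le_trans pb; rewrite ler_wpM2l// subr_ge0.
  have vb'E : v - b' = t * (nu - x) by rewrite b'E /v; ring.
  have vbE : v - b = t * (nu - s) by rewrite /b /v; ring.
  rewrite vb'E vbE -!mulrA -mulrBr ler_pM2l// balance /lose.
  have sx : s <= x by move: bb'; rewrite b'E lerD2l ler_pM2l.
  have xnu : x < nu by move: b'v; rewrite b'E ltrD2l ltr_pM2l.
  have [sr|rs] := leP s (1 - r).
    rewrite below_min0// expr0n gtn_eqF// mulr0 !subr0 mul1r.
    exact: best_gain_term.
  have /andP[h0 h1] := expr_below_max k r x r_gt0.
  rewrite best_gain_above ?(ltW rs)// max_r ?subr_ge0//.
  have : (nu - x) * below_max r x ^+ k <= (nu - x) * 1 by rewrite ler_wpM2l// subr_ge0 ltW.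
  lra.
(* Whenever all opponents bid at most [b'], bid [b] wins as well, so deviating down gains at most
   [b - b'] on that event. *)
set P := \prod_(_ < _ | _) _ in pb' Pe.
have PQ : P <= \prod_(j < n | j != i) pr (Bs j) [set z | z < b].
  apply: ler_prod => j ji; rewrite pr_ge0/= pr_le//; [exact: measurable_le|exact: measurable_lt|].
  by move=> z /= zb'; exact: le_lt_trans b'b.
have xs : x <= s by rewrite -(ler_pM2l t_gt0) -(lerD2l l) -b'E ltW.
apply: (@le_trans _ _ ((v - b') * P - (v - b) * P)).
  by apply: lerB => //; apply: le_trans pb; rewrite ler_wpM2l// subr_ge0.
rewrite -mulrBl (_ : _ - _ - _ = t * (s - x)); last by rewrite b'E /b; ring.
rewrite -mulrA ler_pM2l//.
apply: (le_trans _ (best_gain_term k r 0 s x r_gt0 x0)).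
by rewrite ler_wpM2l// subr_ge0.
Qed.

(** * Lower bounds on the worst loss of every bid *)

Lemma worst_loss_ge_symmetric B b' x c : belief l mu u B -> 0 <= x ->
  payoff i v (fun=> B) b' <= c ->
  (((v - x) * pr B [set z | z <= x] ^+ k - c)%:E <= worst_loss i l mu u v b')%E.
Proof.
have [[hr0 hr1 hl ht] [hs0 hs1 hsn]] := bounds.
move=> Bb x0 pc; rewrite -prod_opponents.
apply: (le_trans (loss_ge_limit i v (fun=> B) b' x c v_ge0 x0 pc)).
by apply: ereal_sup_ubound; exists (fun=> B).
Qed.

Let payoff_symmetric_le B b' : b' <= v ->
  payoff i v (fun=> B) b' <= (v - b') * pr B [set z | z <= b'] ^+ k.
Proof. by move=> b'v; rewrite -prod_opponents; exact: payoff_le. Qed.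

(** The two-point law on [l + t * x] and [u] makes the Markov bound an equality; for [x = 1 - r] it
    is the point mass at [mu]. *)
Let opponent_above x : 0 <= x -> x <= 1 - r -> exists2 B, belief l mu u B &
  pr B [set z | z <= l + t * x] = below_max r x /\
  forall b', pr B [set z | z <= b'] =
    below_max r x * (l + t * x <= b')%R%:R + (1 - below_max r x) * (u <= b')%R%:R.
Proof.
have [[hr0 hr1 hl ht] [hs0 hs1 hsn]] := bounds.
move=> x0 xr.
have tx : 0 < t * (1 - x) by rewrite mulr_gt0//; lra.
have tr : 0 < t * r by rewrite mulr_gt0.
have txr : 0 <= t * (1 - r - x) by rewrite mulr_ge0 ?(ltW ht)//; lra.
have e : below_max r x = (u - mu) / (u - (l + t * x)).
  rewrite /below_max max_r; last by lra.
  by rewrite /u /mu; field; apply/andP; split; lra.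
have e' : 1 - below_max r x = (mu - (l + t * x)) / (u - (l + t * x)).
  by rewrite e /u /mu; field; lra.
have [|||||B Bb BE] := belief_two_point l mu u (l + t * x) u l_ge0.
- by rewrite lerDl mulr_ge0// ltW.
- by rewrite /mu lerD2l ler_pM2l.
- by rewrite /mu /u; lra.
- by [].
- by rewrite /u; lra.
have H b' : pr B [set z | z <= b'] =
    below_max r x * (l + t * x <= b')%R%:R + (1 - below_max r x) * (u <= b')%R%:R.
  rewrite BE; last exact: measurable_le.
  have memE (y : R) : (y \in [set z | z <= b']) = (y <= b') by apply/idP/idP; rewrite inE.
  by rewrite !memE e' e.
exists B => //; split => //; rewrite H lexx mulr1.
have -> : (u <= l + t * x) = false by apply/negbTE; rewrite -ltNge /u; lra.
by rewrite mulr0 addr0.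
Qed.

Lemma worst_loss_underbid b' : 0 <= b' -> b' < b ->
  ((t * best_gain k r 0 s)%:E <= worst_loss i l mu u v b')%E.
Proof.
have [[hr0 hr1 hl ht] [hs0 hs1 hsn]] := bounds.
move=> b'0 b'b.
have b'v : b' <= v by rewrite (le_trans (ltW b'b))// lerD2l ler_pM2l.
have kne0 : (k == 0%N) = false by rewrite gtn_eqF.
apply/lee_addgt0Pr => e e0; rewrite -leeBlDr// -EFinB balance.
have [sr|rs] := leP s (1 - r).
  have et : 0 < e / t by rewrite divr_gt0.
  (* Even the opponents' low point lies above [b'], so [b'] never wins, while bidding just above
     that point earns nearly the best gain. *)
  have [x /andP[sx xr] xe] := best_gain_approx k r s nu (e / t) r_gt0 s_le_nu sr et.
  have x0 := le_trans s_ge0 sx.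
  have [B Bb [Bx BE]] := opponent_above x x0 xr.
  have bx : b' < l + t * x by rewrite (lt_le_trans b'b)// lerD2l ler_pM2l.
  have bu : b' < u.
    by rewrite (lt_le_trans b'b)// lerD2l ler_piMr// ltW.
  have xx0 : 0 <= l + t * x by rewrite addr_ge0// mulr_ge0// ltW.
  apply: le_trans (worst_loss_ge_symmetric B b' (l + t * x) 0 Bb xx0 _); last first.
    rewrite (le_trans (payoff_symmetric_le _ _ b'v))// BE.
    by rewrite (lt_geF bx) (lt_geF bu) !mulr0 addr0 expr0n kne0 mulr0.
  rewrite lee_fin Bx subr0 (_ : v - _ = t * (nu - x)); last by rewrite /v; ring.
  have : t * (lose k r s * best_gain k r s nu) <= t * best_gain k r s nu.
    by rewrite ler_pM2l// ler_piMl ?best_gain_ge0// lose_le1.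
  move: xe; rewrite -(ltr_pM2l t_gt0) mulrBr (mulrC t (e / t)) divfK ?gt_eqF//; lra.
have L0 : 0 <= lose k r s <= 1 by rewrite lose_le1// ltW ?lose_gt0.
rewrite best_gain_above ?(ltW rs)// max_r ?subr_ge0//.
(* A bid below [mu] always loses to opponents who surely bid [mu], and the forgone margin [v - mu]
   exceeds [v - b]. *)
have [mub'|b'mu] := leP mu b'; last first.
  have r1 : 0 <= 1 - r by lra.
  have [B Bb [Bx BE]] := opponent_above (1 - r) r1 (lexx _).
  apply: le_trans (worst_loss_ge_symmetric B b' mu 0 Bb _ _); last 2 first.
  - by rewrite /mu addr_ge0// mulr_ge0// ltW.
  - rewrite (le_trans (payoff_symmetric_le _ _ b'v))// BE below_max1//.
    by rewrite (lt_geF b'mu) mulr0 add0r subrr mul0r expr0n kne0 mulr0.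
  rewrite lee_fin Bx below_max1// expr1n mulr1 subr0.
  have : lose k r s * (nu - s) <= nu - s by rewrite ler_piMl ?subr_ge0//; case/andP: L0.
  by rewrite -(ler_pM2l t_gt0) /v /mu; nra.
(* Opponents bid [l] or slightly above [b']; [d <= b - b'] keeps the upper point at most [b], so the
   weight at [l] is at most [below_min r s]. *)
pose d := Num.min e (b - b').
have d0 : 0 < d by rewrite lt_min e0 subr_gt0.
have de : d <= e by rewrite ge_min lexx.
have db : d <= b - b' by rewrite ge_min lexx orbT.
have bu : b <= u by rewrite lerD2l ler_piMr// ltW.
have lmu : l < mu by rewrite ltrDl mulr_gt0// subr_gt0.
have [||||B Bb BE] := belief_two_point l mu u l (b' + d) l_ge0 (lexx _); [lra..|].
have B1 : pr B [set z | z <= b' + d] = 1.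
  rewrite BE; last exact: measurable_le.
  by rewrite !mem_set/=; [field|..]; lra.
have Bq : pr B [set z | z <= b'] <= below_min r s.
  rewrite BE; last exact: measurable_le.
  rewrite mem_set/=; last by lra.
  rewrite memNset/=; last by apply/negP; rewrite -ltNge ltrDl.
  have [ts tsr] := ts_gt rs.
  have -> : below_min r s = (b - mu) / (b - l).
    rewrite /below_min max_l ?(ltW rs)// /b /mu; field.
    by apply/andP; split; lra.
  rewrite mulr1 mulr0 addr0 ler_pdivrMr; last by lra.
  rewrite mulrAC ler_pdivlMr; last by lra.
  nra.
have xx0 : 0 <= b' + d by lra.
pose c := (v - b') * below_min r s ^+ k.
apply: le_trans (worst_loss_ge_symmetric B b' (b' + d) c Bb xx0 _); last first.
  rewrite (le_trans (payoff_symmetric_le _ _ b'v))// ler_wpM2l ?subr_ge0//.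
  by apply: le_expr => //; exact: pr_ge0.
rewrite lee_fin B1 expr1n mulr1.
have : (v - b) * lose k r s <= (v - b') * lose k r s.
  by rewrite ler_wpM2r//; [case/andP: L0|lra].
rewrite {1}/v {1}/b /c /lose; lra.
Qed.

Lemma worst_loss_overbid b' : 0 <= b' -> b <= b' ->
  ((t * best_gain k r 0 s)%:E <= worst_loss i l mu u v b')%E.
Proof.
have [[hr0 hr1 hl ht] [hs0 hs1 hsn]] := bounds.
move=> b'0 bb'; apply/lee_addgt0Pr => e e0; rewrite -leeBlDr// -EFinB.
have et : 0 < e / t by rewrite divr_gt0.
have r1 : 0 <= 1 - r by lra.
have [x /andP[x0 xr] xe] := best_gain_approx k r 0 s (e / t) r_gt0 s_ge0 r1 et.
have [B Bb [Bx BE]] := opponent_above x x0 xr.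
have xx0 : 0 <= l + t * x by rewrite addr_ge0// mulr_ge0// ltW.
have {}xe : t * best_gain k r 0 s - e <= (b - (l + t * x)) * below_max r x ^+ k.
  move: xe; rewrite -(ltr_pM2l t_gt0) mulrBr (mulrC t (e / t)) divfK ?gt_eqF// => /ltW.
  by rewrite /b; lra.
have h0 : 0 <= below_max r x ^+ k by rewrite exprn_ge0// below_max_ge0.
have bv : b <= v by rewrite lerD2l ler_pM2l.
have [vb'|b'v] := leP v b'.
  apply: le_trans (worst_loss_ge_symmetric B b' (l + t * x) 0 Bb xx0 (payoff_le0 _ _ _ _ vb')).
  rewrite lee_fin subr0 Bx (le_trans xe)// ler_wpM2r//; lra.
(* For [u <= b'], opponents surely bidding [mu] cost [b' - mu >= t * r], and [s <= 1] bounds the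
   overbidding part by [t * r]. *)
have [ub'|b'u] := leP u b'.
  have [B' Bb' [Bx' BE']] := opponent_above (1 - r) r1 (lexx _).
  have mu0 : 0 <= mu by rewrite /mu addr_ge0// mulr_ge0// ltW.
  apply: le_trans (worst_loss_ge_symmetric B' b' mu (v - b') Bb' mu0 _); last first.
    rewrite (le_trans (payoff_symmetric_le _ _ (ltW b'v)))// ler_piMr//; first by lra.
    by rewrite exprn_ile1 ?pr_ge0 ?pr_le1//; exact: measurable_le.
  rewrite lee_fin Bx' below_max1// expr1n mulr1.
  have : t * best_gain k r 0 s <= t * r.
    by rewrite ler_pM2l// -[leRHS](best_gain01 k k_gt0)// best_gain_homo_r.
  by rewrite /mu; move: ub'; rewrite /u; lra.
(* For [b' < u], bid [b'] wins only if all opponents are at their low point, an event on which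
   bidding just above that point also wins. *)
pose c := (v - b') * below_max r x ^+ k.
apply: le_trans (worst_loss_ge_symmetric B b' (l + t * x) c Bb xx0 _); last first.
  rewrite (le_trans (payoff_symmetric_le _ _ (ltW b'v)))// ler_wpM2l ?subr_ge0 ?(ltW b'v)//.
  apply: le_expr; first exact: pr_ge0.
  rewrite BE (lt_geF b'u) mulr0 addr0 ler_piMr ?below_max_ge0//.
  by case: (_ <= b').
rewrite lee_fin Bx (le_trans xe)// -mulrBl ler_wpM2r//; lra.
Qed.

(** One level bounds the worst loss of the balanced bid from above and that of every bid from
    below. *)
Lemma minimax_norm_bid : minimax_bid i l mu u v b.
Proof.
have [[hr0 hr1 hl ht] [hs0 hs1 hsn]] := bounds.
have b0 : 0 <= b by rewrite addr_ge0// mulr_ge0// ltW.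
split => //; apply/eqP; rewrite eq_le; apply/andP; split; last first.
  by apply: ereal_inf_lbound; exists b.
apply: le_ereal_inf_tmp => _ [b' b'0 <-].
apply: (le_trans worst_loss_norm_bid_le).
by have [|] := ltP b' b; [exact: worst_loss_underbid|exact: worst_loss_overbid].
Qed.

End minimax.

(** * Support and fixed point *)

Section support.
Context {R : realType} (F : probability R R).

Lemma notin_supp x : ~ supp F x -> exists2 e : R, 0 < e & F (ball x e) = 0%E.
Proof.
move=> /existsNP[e] /not_implyP[e0] /negP; rewrite -leNgt => Fe.
by exists e => //; apply/eqP; rewrite eq_le Fe measure_ge0.
Qed.

Lemma supp_closed : closed (supp F).
Proof.
rewrite -openC; rewrite openE => x /notin_supp[e e0 Fe].
exists (e / 2) => /=; first by rewrite divr_gt0.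
move=> y /= xy /(_ (e / 2)).
have -> : F (ball y (e / 2)) = 0%E.
  apply: (subset_measure0 (B := ball x e)) => //; [exact: measurable_ball..|].
  by move=> z yz; rewrite /ball/= (splitr e) (le_lt_trans (ler_distD y _ _))// ltrD.
by rewrite ltxx => H; have := H ltac:(by rewrite divr_gt0).
Qed.

Lemma measurable_supp : measurable (supp F).
Proof. exact: closed_measurable supp_closed. Qed.

(** The complement of the support is covered by countably many null intervals with rational
    endpoints. *)
Lemma probability_supp : F (supp F) = 1%E.
Proof.
have mC : measurable (~` supp F) by apply: measurableC; exact: measurable_supp.
suff C0 : F (~` supp F) = 0%E.
  rewrite -[supp F]setCK probability_setC// C0 sube0//.
pose I (q : rat * rat) : set R := `]ratr q.1, ratr q.2[%classic.
(* Codes of no pair, and of intervals of positive mass, give the empty set. *)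
pose A (m : nat) : set R :=
  if @unpickle (rat * rat)%type m is Some q then
    if F (I q) == 0%E then I q else set0
  else set0.
have AE q : F (I q) = 0%E -> A (pickle q) = I q.
  by move=> F0; rewrite /A pickleK F0 eqxx.
apply/negligibleP => //; apply: (@negligibleS _ _ _ F (\bigcup_m A m)).
  move=> x /notin_supp[e e0 Fe].
  have [q1 q1x] := @rat_in_itvoo R (x - e) x ltac:(lra).
  have [q2 xq2] := @rat_in_itvoo R x (x + e) ltac:(lra).
  move: q1x xq2; rewrite !in_itv => /andP[q1a q1b] /andP[q2a q2b].
  have F0 : F (I (q1, q2)) = 0%E.
    apply: (subset_measure0 (B := ball x e)) Fe; [exact: measurable_itv|exact: measurable_ball|].
    move=> z; rewrite /I set_itvE => /andP[z1 z2]; rewrite /ball/= ltr_distlC.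
    by apply/andP; split; [exact: lt_trans z1|exact: lt_trans q2b].
  have Ix : I (q1, q2) x by rewrite /I set_itvE; apply/andP; split.
  by exists (pickle (q1, q2)); [exact: Logic.I|rewrite AE].
apply: negligible_bigcup => m; rewrite /A.
case: unpickle => [q|]; last exact: negligible_set0.
case: ifPn => [/eqP F0|_]; last exact: negligible_set0.
by apply/negligibleP => //; exact: measurable_itv.
Qed.

End support.

(** * A belief parameter consistent with the mean bid *)

Section fixed_point.
Context {R : realType} (F : probability R R) (vl vh : R) (k : nat).
Hypotheses (k_gt0 : (0 < k)%N) (vlh : vl < vh).
Hypotheses (suppF : supp F `<=` `[vl, vh]) (suppl : supp F vl) (supph : supp F vh).

Implicit Types r v w x : R.

Let V_gt0 : 0 < vh - vl. Proof. by rewrite subr_gt0. Qed.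

(** The unit of length is [(vh - vl) / top_value k r], so that [vh] becomes [top_value k r].
    Truncation at [0] keeps values below [vl] in the domain where [norm_bid] is specified. *)
Definition norm_value r v : R := Num.max 0 (v - vl) / (vh - vl) * top_value k r.

Definition share r v : R := norm_bid k r (norm_value r v).

Lemma norm_value_ge0 r v : 0 < r < 1 -> 0 <= norm_value r v.
Proof.
move=> r01; rewrite mulr_ge0 ?divr_ge0 ?le_max ?lexx ?(ltW V_gt0)//.
by rewrite (le_trans _ (top_value_ge1 k k_gt0 r r01)).
Qed.

Lemma top_value_gt0 r : 0 < r < 1 -> 0 < top_value k r.
Proof. by move=> r01; rewrite (lt_le_trans ltr01)// top_value_ge1. Qed.

Lemma norm_value_homo r : 0 < r < 1 -> {homo norm_value r : v w / v <= w}.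
Proof.
move=> r01 v w vw; rewrite ler_pM2r ?top_value_gt0// ler_pM2r ?invr_gt0//.
by rewrite ge_max !le_max lexx/= lerD2r vw orbT.
Qed.

Lemma norm_value_lt r v w : 0 < r < 1 -> vl <= v -> v < w -> norm_value r v < norm_value r w.
Proof.
move=> r01 lv vw; rewrite ltr_pM2r ?top_value_gt0// ltr_pM2r ?invr_gt0//.
by rewrite !max_r ?ltrD2r// subr_ge0// (le_trans lv)// ltW.
Qed.

Lemma share_ge0 r v : 0 < r < 1 -> 0 <= share r v.
Proof.
by move=> r01; have [/andP[]] := norm_bidP k k_gt0 r _ r01 (norm_value_ge0 r v r01).
Qed.

Lemma share_le_value r v : 0 < r < 1 -> share r v <= norm_value r v.
Proof.
by move=> r01; have [/andP[]] := norm_bidP k k_gt0 r _ r01 (norm_value_ge0 r v r01).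
Qed.

Lemma share_homo r : 0 < r < 1 -> {homo share r : v w / v <= w}.
Proof.
move=> r01 v w vw; rewrite /share.
have := norm_value_homo r r01 v w vw; rewrite le_eqVlt => /predU1P[-> //|vw'].
by apply: ltW; apply: norm_bid_lt => //; exact: norm_value_ge0.
Qed.

Lemma share_lt r v w : 0 < r < 1 -> vl <= v -> v < w -> share r v < share r w.
Proof.
move=> r01 lv vw; apply: norm_bid_lt => //; first exact: norm_value_ge0.
exact: norm_value_lt.
Qed.

Lemma share_vl r : 0 < r < 1 -> share r vl = 0.
Proof.
move=> r01; apply/eqP; rewrite eq_le share_ge0// andbT.
by rewrite (le_trans (share_le_value r vl r01))// /norm_value subrr maxxx !mul0r.
Qed.

Lemma share_vh r : 0 < r < 1 -> share r vh = 1.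
Proof.
move=> r01; rewrite /share /norm_value max_r ?(ltW V_gt0)// divff ?gt_eqF// mul1r.
exact: norm_bid_top.
Qed.

Lemma share_le1 r v : 0 < r < 1 -> supp F v -> share r v <= 1.
Proof.
move=> r01 /suppF; rewrite /= in_itv/= => /andP[_ vh1].
by rewrite -(share_vh r r01); exact: share_homo.
Qed.

Lemma measurable_share r (D : set R) : 0 < r < 1 -> measurable D -> measurable_fun D (share r).
Proof. by move=> r01 mD; apply: nondecreasing_measurable => //; exact: share_homo. Qed.

Lemma top_value_continuous r : 0 < r < 1 -> {for r, continuous (top_value k)}.
Proof.
move=> r01; have /andP[_ rk1] := expr_gt0_lt1 k k_gt0 r r01.
apply: cvgD; first exact: cvg_cst.
apply: cvgM => //; apply: cvgV; first by rewrite subr_eq0 gt_eqF.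
by apply: cvgB; [exact: cvg_cst|exact: exprn_continuous].
Qed.

Lemma share_continuous v r : 0 < r < 1 -> {for r, continuous (share^~ v)}.
Proof.
move=> r01; apply: (@norm_bid_continuous _ k k_gt0 (norm_value^~ v)) => //.
- by apply: cvgM; [exact: cvg_cst|exact: top_value_continuous].
- by move=> x x01; exact: norm_value_ge0.
Qed.

Let mD := measurable_supp F.

Lemma integrable_share r : 0 < r < 1 -> F.-integrable (supp F) (EFin \o share r).
Proof.
move=> r01; apply: measurable_bounded_integrable => //.
- by rewrite (le_lt_trans (probability_le1 _ _))// ltry.
- exact: measurable_share.
exists 1; split; first exact: num_real.
move=> M M1 v Dv /=; rewrite ger0_norm ?share_ge0//.
by rewrite (le_trans (share_le1 r v r01 Dv))// ltW.
Qed.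

Definition mean_share r : R := \int[F]_(v in supp F) share r v.

Lemma mean_shareE r : 0 < r < 1 ->
  (\int[F]_(v in supp F) (share r v)%:E = (mean_share r)%:E)%E.
Proof. by move=> r01; rewrite fineK// integrable_fin_num//; exact: integrable_share. Qed.

(** Dominated convergence: on the support all shares are at most [1]. *)
Lemma mean_share_continuous r : 0 < r < 1 -> {for r, continuous mean_share}.
Proof.
move=> r01.
apply: (@continuity_under_integral R _ _ F share (supp F) mD 0 1 _ _ (cst 1)).
- by move=> x; rewrite /= in_itv/= => x01; exact: integrable_share.
- apply: aeW => v _ x; rewrite inE/= in_itv/= => x01; exact: share_continuous.
- apply: measurable_bounded_integrable => //; last exact: bounded_cst.
  by rewrite (le_lt_trans (probability_le1 _ _))// ltry.
- move=> x; rewrite /= in_itv/= => x01; apply: aeW => v Dv.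
  by rewrite ger0_norm ?share_ge0//; exact: share_le1.
- by rewrite inE/= in_itv.
Qed.

Let ball_gt0 x : supp F x -> 0 < pr F (ball x ((vh - vl) / 2)).
Proof.
move=> Sx; rewrite -lte_fin prE; last exact: measurable_ball.
by apply: Sx; rewrite divr_gt0.
Qed.

Let ball_le1 x : pr F (ball x ((vh - vl) / 2)) <= 1.
Proof. by rewrite pr_le1//; exact: measurable_ball. Qed.

(** Shares never exceed normalised values, which are at most [top_value k r] on the support and half
    of that near [vl]. *)
Lemma mean_share_le r : 0 < r < 1 ->
  mean_share r <= (1 - pr F (ball vl ((vh - vl) / 2)) / 2) * top_value k r.
Proof.
move=> r01; have V0 := V_gt0; set e := (vh - vl) / 2; set A := ball vl e.
have t0 := top_value_gt0 r r01.
have mA : measurable A by exact: measurable_ball.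
have mCA : measurable (~` A) by exact: measurableC.
rewrite -lee_fin -mean_shareE//.
have -> : (1 - pr F A / 2) * top_value k r =
    top_value k r / 2 + top_value k r / 2 * pr F (~` A).
  by rewrite pr_setC//; field.
rewrite -(integral_step F (supp F))//; [|exact: probability_supp|lra|lra].
apply: ge0_le_integral => //.
- by move=> v _; rewrite lee_fin share_ge0.
- by apply/measurable_EFinP; exact: measurable_share.
- apply/measurable_EFinP; apply: measurable_funD => //; apply: measurable_funM => //.
move=> v Dv; rewrite lee_fin indicE.
have [vA|vA] := boolP (v \in ~` A).
  rewrite mulr1 -splitr (le_trans (share_le_value r v r01))//.
  rewrite ler_piMl ?(ltW t0)// ler_pdivrMr// mul1r ge_max (ltW V0)/=.
  by have /suppF := Dv; rewrite /= in_itv/= => /andP[? ?]; lra.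
rewrite mulr0 addr0 (le_trans (share_le_value r v r01))//.
have {}vA : A v by move: vA; rewrite notin_setE => /contrapT.
rewrite [leRHS]mulrC ler_pM2r// ler_pdivrMr// ge_max mulr_ge0 ?(ltW V0)//=.
by move: vA; rewrite /A /ball/= distrC => /ltW /(le_trans (ler_norm _)); rewrite /e; lra.
Qed.

(** Values within half the range of [vh] normalise to at least half of [top_value k r], so their
    shares are bounded below uniformly in [r]. *)
Lemma mean_share_ge r : 2^-1 <= r < 1 -> 1 - r <= (4 * k%:R)^-1 ->
  (4 * k%:R)^-1 * pr F (ball vh ((vh - vl) / 2)) <= mean_share r.
Proof.
move=> hr hrk; have V0 := V_gt0; set e := (vh - vl) / 2; set A := ball vh e.
have r01 : 0 < r < 1 by case/andP: hr => ? ?; apply/andP; split; lra.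
have mA : measurable A by exact: measurable_ball.
have t0 := top_value_gt0 r r01.
rewrite -lee_fin -mean_shareE// -[X in X%:E]add0r.
have s0 : 0 <= (4 * k%:R : R)^-1 by rewrite invr_ge0 mulr_ge0.
rewrite -(integral_step F (supp F))//; last exact: probability_supp.
apply: ge0_le_integral => //.
- apply/measurable_EFinP; apply: measurable_funD => //; apply: measurable_funM => //.
- by apply/measurable_EFinP; exact: measurable_share.
move=> v Dv; rewrite lee_fin indicE add0r.
have [vA|vA] := boolP (v \in (A : set R)); last by rewrite mulr0 share_ge0.
rewrite mulr1; apply: norm_bid_ge => //.
rewrite /norm_value mulrC ler_pM2r// ler_pdivlMr//.
move: vA; rewrite inE /A /ball/= => /ltW /(le_trans (ler_norm _)) vA.
rewrite le_max; apply/orP; right.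
by move: vA; rewrite /e; lra.
Qed.

Lemma top_value_le r : 0 < r < 1 -> top_value k r <= (1 - r)^-1.
Proof.
move=> /[dup] r01 /andP[r0 r1]; have /andP[rk0 rk1] := expr_gt0_lt1 k k_gt0 r r01.
have rk : r ^+ k <= r by apply: ler_iXnr => //; exact: ltW.
have -> : (1 - r)^-1 = 1 + r / (1 - r) by field; lra.
by rewrite lerD2l ler_pM2l// lef_pV2 ?posrE ?subr_gt0//; lra.
Qed.

Lemma exists_fixed_point : exists2 r, 0 < r < 1 & mean_share r = 1 - r.
Proof.
set a := pr F (ball vl ((vh - vl) / 2)); set p := pr F (ball vh ((vh - vl) / 2)).
have a0 : 0 < a by exact: ball_gt0.
have a1 : a <= 1 by exact: ball_le1.
have p0 : 0 < p by exact: ball_gt0.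
have p1 : p <= 1 by exact: ball_le1.
set s := (4 * k%:R : R)^-1.
have s0 : 0 < s by rewrite invr_gt0 mulr_gt0 ?ltr0n.
have s1 : s <= 4^-1.
  rewrite lef_pV2 ?posrE ?mulr_gt0 ?ltr0n//.
  by rewrite ler_peMr// ler1n.
have sp0 : 0 < s * p by rewrite mulr_gt0.
have sps : s * p <= s by rewrite ler_piMr// ltW.
(* At [r0] the mean is at most [(1 - a / 2) / (1 - r0) <= 1 - r0], because
   [1 - a / 2 <= (1 - a / 4) ^+ 2]. At [r1] the lower bound [s * p] on the mean is exactly
   [1 - r1]. *)
pose r0 := a / 4; pose r1 := 1 - s * p.
have r001 : 0 < r0 < 1 by rewrite /r0; apply/andP; split; lra.
have r101 : 0 < r1 < 1 by rewrite /r1; apply/andP; split; lra.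
pose f r := mean_share r + r.
have f0 : f r0 <= 1.
  have := mean_share_le r0 r001; rewrite -/a => H1.
  have : (1 - a / 2) * top_value k r0 <= 1 - r0.
    apply: (@le_trans _ _ ((1 - a / 2) / (1 - r0))).
      by rewrite ler_wpM2l ?top_value_le//; lra.
    by rewrite ler_pdivrMr /r0; [nra|lra].
  by rewrite /f; lra.
have f1 : 1 <= f r1.
  have : s * p <= mean_share r1.
    by apply: mean_share_ge; rewrite -/s /r1; [apply/andP; split; lra|lra].
  by rewrite /f /r1; lra.
have r0r1 : r0 <= r1 by rewrite /r0 /r1; lra.
have cf : {within `[r0, r1], continuous f}.
  apply: continuous_in_subspaceT => x; rewrite inE/= in_itv/= => /andP[x0 x1].
  have x01 : 0 < x < 1.
    by case/andP: r001 => ? ?; case/andP: r101 => ? ?; apply/andP; split; lra.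
  by apply: cvgD; [exact: mean_share_continuous|exact: cvg_id].
have [|c] := @IVT _ f r0 r1 1 r0r1 cf; first by rewrite ge_min le_max f0 f1 orbT.
rewrite in_itv/= => /andP[c0 c1] fc; exists c; last by move: fc; rewrite /f; lra.
by case/andP: r001 => ? ?; case/andP: r101 => ? ?; apply/andP; split; lra.
Qed.

End fixed_point.

(** * Degenerate support and assembly of the equilibrium *)

Lemma ereal_inf_attained (R : realType) (A : set (\bar R)) x :
  A x -> lbound A x -> ereal_inf A = x.
Proof.
move=> Ax lbx; apply/eqP; rewrite eq_le; apply/andP; split.
  exact: ereal_inf_lbound.
exact: le_ereal_inf_tmp.
Qed.

Lemma ereal_sup_attained (R : realType) (A : set (\bar R)) x :
  A x -> ubound A x -> ereal_sup A = x.
Proof.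
move=> Ax ubx; apply/eqP; rewrite eq_le; apply/andP; split.
  exact: ge_ereal_sup.
exact: ereal_sup_ubound.
Qed.

(** Opponents surely bid [v], so no lower bid wins and bidding [v] loses nothing. *)
Lemma minimax_bid_known (R : realType) (n : nat) (i : 'I_n) (v : R) :
  (1 < n)%N -> 0 <= v -> minimax_bid i v v v v v.
Proof.
move=> n1 v0; split => //; apply/eqP; rewrite eq_le; apply/andP; split; last first.
  by apply: ereal_inf_lbound; exists v.
apply: (@le_trans _ _ 0%E).
  apply: ge_ereal_sup => _ [Bs Bb <-]; apply: loss_le => b b0.
  rewrite {2}/payoff subrr mul0r subr0.
  have [vb|bv] := leP v b; first exact: payoff_le0.
  have [j ji] := exists_opponent i n1.
  rewrite (le_trans (payoff_le i v Bs b (ltW bv)))//.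
  by rewrite (bigD1 j)//= (belief_pr_le0 _ _ _ _ _ (Bb j ji) bv) mul0r mulr0.
apply: le_ereal_inf_tmp => _ [b b0 <-].
(* The point mass at [v] shows that the belief set is nonempty; over an empty set the worst loss
   would be [-oo]. *)
have p01 : 0 <= (1 : R) <= 1 by rewrite lexx ler01.
have [B [BE Bint]] := two_point_probability 1 v v p01 v0 v0.
have B1 A : measurable A -> v \in A -> B A = 1%E.
  by move=> mA vA; rewrite -prE// BE// vA subrr mul0r addr0 mulr1.
apply: (@le_trans _ _ (loss i v (fun=> B) b)).
  by have := loss_ge i v (fun=> B) b b _ b0 (lexx _); rewrite subrr.
apply: ereal_sup_ubound; exists (fun=> B) => // j _; split; [|split].
- by apply: B1 => //; rewrite inE/= in_itv/= andbT.
- by apply: B1 => //; rewrite inE/= in_itv/= lexx.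
- by rewrite Bint subrr mul0r addr0 mul1r.
Qed.

Theorem theorem2 (R : realType) (n : nat) (F : probability R R) (vl vh : R) :
  (2 <= n)%N ->
  0 <= vl -> vl <= vh ->
  supp F `<=` `[vl, vh]%classic -> supp F vl -> supp F vh ->
  exists l mu u : R, exists beta : R -> R,
    @moment_equilibrium R n F (fun _ => beta) (fun _ => l) (fun _ => mu) (fun _ => u)
    /\ (forall v w, supp F v -> supp F w -> v < w -> beta v < beta w).
Proof.
move=> n2 vl0 vlh suppF suppl supph.
have mD := measurable_supp F.
move: vlh; rewrite le_eqVlt => /predU1P[vE|vlh].
  (* With a single possible value, everyone bids it and is believed to do so. *)
  have suppE v : supp F v -> v = vl.
    by move=> /suppF; rewrite /= in_itv/= -vE => vv; apply/eqP; rewrite eq_le andbC.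
  exists vl, vl, vl, (cst vl); split; last first.
    by move=> v w /suppE -> /suppE ->; rewrite ltxx.
  split; first by [].
  split; first by [].
  split; first by move=> i v /suppE ->; exact: minimax_bid_known.
  split.
    move=> _ _ _; transitivity (\int[F]_(v in supp F) cst vl%:E v)%E; first by [].
    by rewrite integral_cst// [X in (_ * X)%E]probability_supp mule1.
  move=> _ _ _; split; [apply: ereal_inf_attained|apply: ereal_sup_attained];
    by [exists vl|move=> _ [v _ <-]].
have k0 : (0 < n.-1)%N by case: (n) n2 => [|[]].
have [r r01 rfix] := exists_fixed_point F vl vh _ k0 vlh suppF suppl supph.
have tv0 := top_value_gt0 _ k0 r r01.
have V0 : 0 < vh - vl by rewrite subr_gt0.
(* This bid range makes the highest type bid exactly the upper end [vl + t]. *)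
pose t := (vh - vl) / top_value n.-1 r.
have t0 : 0 < t by rewrite divr_gt0.
pose sh := share vl vh n.-1 r.
have sh0 v : 0 <= sh v by exact: share_ge0.
exists vl, (vl + t * (1 - r)), (vl + t), (fun v => vl + t * sh v).
have suppl_le v : supp F v -> vl <= v by move=> /suppF; rewrite /= in_itv/= => /andP[].
have beta_lt v w : supp F v -> supp F w -> v < w -> vl + t * sh v < vl + t * sh w.
  by move=> Sv Sw vw; rewrite ltrD2l ltr_pM2l//; apply: share_lt => //; exact: suppl_le.
split => //.
have msh : measurable_fun (supp F) sh by exact: measurable_share.
split; first by move=> _; apply: measurable_funD => //; apply: measurable_funM.
split; first by move=> _ v _; rewrite addr_ge0// mulr_ge0// ltW.
split.
  move=> i v Sv; have lv := suppl_le v Sv.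
  (* On the support the truncation in [norm_value] is inactive, so values and bids share the same
     units. *)
  have vE : v = vl + t * norm_value vl vh n.-1 r v.
    rewrite /norm_value /t max_r ?subr_ge0//; field.
    by apply/andP; split; rewrite gt_eqF.
  have nv0 := norm_value_ge0 _ _ _ k0 vlh r v r01.
  have [/andP[b0 bn] be] := norm_bidP n.-1 k0 r _ r01 nv0.
  rewrite [X in minimax_bid _ _ _ _ X _]vE.
  apply: minimax_norm_bid => //.
  exact: (share_le1 F vl vh n.-1 k0 vlh suppF r v r01 Sv).
split.
  move=> _ _ _; under eq_integral do rewrite EFinD.
  rewrite ge0_integralD//; last 2 first.
  - by move=> v _; rewrite lee_fin mulr_ge0// ltW.
  - by apply/measurable_EFinP; apply: measurable_funM.
  rewrite integral_cst// [X in (_ * X)%E]probability_supp mule1.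
  under eq_integral do rewrite EFinM.
  rewrite ge0_integralZl//;
    [|exact/measurable_EFinP|by move=> v _; rewrite lee_fin|by rewrite lee_fin ltW].
  by rewrite (mean_shareE F vl vh n.-1 k0 vlh suppF)// rfix.
move=> _ _ _; split.
  apply: ereal_inf_attained.
    by exists vl => //; rewrite /sh share_vl// mulr0 addr0.
  by move=> _ [v _ <-]; rewrite lee_fin lerDl mulr_ge0// ltW.
apply: ereal_sup_attained.
  by exists vh => //; rewrite /sh share_vh// mulr1.
move=> _ [v Sv <-]; rewrite lee_fin lerD2l ler_piMr// ?(ltW t0)//.
exact: (share_le1 F vl vh n.-1 k0 vlh suppF r v r01 Sv).
Qed.
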